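(* Let $(L\rightrightarrows L_M;G\rightrightarrows M)$ be an LBG and let $\theta,\theta' \in \Omega^1(G,L)$ be multiplicative and $\partial$-cohomologous $1$-forms: $\theta - \theta' =\partial \alpha$ for some $\alpha \in \Omega^1(M,L_M)$. Then the map $\mathsf A \colon \mathsf MK_\theta \to \mathsf MK_{\theta'}$ defined by $\mathsf A(v,\lambda)= \big(v, \lambda +s^{\ast}\alpha(v)\big)$ for $v\in TG$, $\lambda\in L$ (over the same arrow), and $\mathsf{A} (v,\lambda)= \big(v, \lambda+\alpha(v)\big)$ for $v\in TM$, $\lambda \in L_M$ (over the same point), is a VB-Morita map.
   Context: Lie groupoids are Hausdorff; $s,t,m,u,i$ are source, target, multiplication, unit, inversion; $gh$ is defined when $s(g)=t(h)$; $G^{(2)}$ is the manifold of composable pairs; $TG\rightrightarrows TM$ is the tangent groupoid. A Lie groupoid morphism $f\colon(H\rightrightarrows N)\to(G\rightrightarrows M)$ is a Morita map if (i) $H$ is, via $f$ and $(s,t)$, the fibre product of $(s,t)\colon G\to M\times M$ and $f\times f\colon N\times N\to M\times M$, and (ii) $\{(g,y)\in G\times N: s(g)=f(y)\}\to M$, $(g,y)\mapsto t(g)$, is a surjective submersion. A VB-groupoid (VBG) $(V\rightrightarrows V_M;G\rightrightarrows M)$ consists of Lie groupoids $V\rightrightarrows V_M$, $G\rightrightarrows M$ and vector bundles $V\to G$, $V_M\to M$ such that all structure maps of $V$ are vector bundle (VB) morphisms covering those of $G$. A VBG morphism $(F,f)$ consists of Lie groupoid morphisms $F\colon(W\rightrightarrows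 W_N)\to(V\rightrightarrows V_M)$, $f\colon(H\rightrightarrows N)\to(G\rightrightarrows M)$ with $F$ a VB morphism over $f$ on arrows and on objects; it is a VB-Morita map if $F$ is a Morita map. A line bundle-groupoid (LBG) is a VBG $(L\rightrightarrows L_M;G\rightrightarrows M)$ with $L\to G$, $L_M\to M$ line bundles; its structure maps are then fibrewise isomorphisms; $s_g\colon L_g\to L_{M,s(g)}$. For a fibrewise isomorphism $(F,f)\colon(E\to X)\to(E'\to X')$ and $\theta\in\Omega^k(X',E')$, $(F^*\theta)_x(v_1,\dots)=F_x^{-1}(\theta_{f(x)}(df(v_1),\dots))$. For $\alpha\in\Omega^k(M,L_M)$, $\partial\alpha=s^*\alpha-t^*\alpha\in\Omega^k(G,L)$; for $\theta\in\Omega^k(G,L)$, $\partial\theta=\mathrm{pr}_2^*\theta-m^*\theta+\mathrm{pr}_1^*\theta\in\Omega^k(G^{(2)},L^{(2)})$; $\theta$ is multiplicative if $\partial\theta=0$. For multiplicative $\theta\in\Omega^1(G,L)$, the Morita kernel $\mathsf MK_\theta$ is the VBG $(TG\oplus L\rightrightarrows TM\oplus L_M;G\rightrightarrows M)$ with $s(v,\lambda)=(s(v),s(\lambda))$, $t(v,\lambda)=(t(v),t(\lambda+\theta(v)))$, $u(v,\lambda)=(u(v),u(\lambda))$, $(v,\lambda)^{-1}=(v^{-1},s_{g^{-1}}^{-1}(t(\lambda+\theta(v))))$ for $(v,\lambda)$ over $g$, and $(v,\lambda)\cdot(v',\lambda')=(vv',s_{gg'}^{-1}(s(\lambda')))$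 for composable arrows over $g,g'$. *)

(* Defs.v *)
(* Smooth manifolds, vector bundles and Lie groupoids are raw data (charts, local
   trivializations, structure maps) together with Prop-valued predicates [is_...]
   collecting their axioms. Manifolds have constant dimension and vector bundles
   constant rank. *)
From HB Require Import structures.
From mathcomp Require Import all_boot all_order all_algebra.
From mathcomp Require Import all_classical all_reals all_analysis.
Set Implicit Arguments.
Unset Strict Implicit.
Unset Printing Implicit Defensive.
Import Order.TTheory GRing.Theory Num.Theory.
Import numFieldNormedType.Exports.
Local Open Scope classical_set_scope.
Local Open Scope ring_scope.

(** * Smooth maps between open subsets of coordinate spaces *)

Section Calculus.
Context {R : realType} {n k : nat}.

(* Only used with [W] open. *)
Fixpoint of_class_C (r : nat) (W : set 'rV[R]_n) (F : 'rV[R]_n -> 'rV[R]_k) :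
    Prop :=
  match r with
  | 0%N => forall x, W x -> {for x, continuous F}
  | r'.+1 => (forall x, W x -> differentiable F x) /\
             (forall v, of_class_C r' W (fun x => 'd F x v))
  end.

Definition smooth_on (W : set 'rV[R]_n) (F : 'rV[R]_n -> 'rV[R]_k) : Prop :=
  forall r, of_class_C r W F.

End Calculus.

(** * Manifolds *)

(* The value of [cmap] outside [cdom] is irrelevant. *)
Record chart (R : realType) (X : Type) (n : nat) := Chart {
  cdom : set X;
  cmap : X -> 'rV[R]_n }.

Record charted (R : realType) := Charted {
  carrier :> Type;
  mdim : nat;
  atlas : set (chart R carrier mdim) }.

(* [F] is smooth on a neighbourhood W of the coordinates of [x], and there
   F = psi o f o phi^-1; in particular phi(cdom phi) contains W. *)
Definition local_rep (R : realType) (X Y : Type) (n k : nat) (f : X -> Y)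
    (x : X) (phi : chart R X n) (psi : chart R Y k)
    (F : 'rV[R]_n -> 'rV[R]_k) : Prop :=
  exists W : set 'rV[R]_n,
    [/\ open W, W (cmap phi x), W `<=` cmap phi @` cdom phi, smooth_on W F &
        forall z, cdom phi z -> W (cmap phi z) ->
          cdom psi (f z) /\ cmap psi (f z) = F (cmap phi z)].

(* The transition map psi o phi^-1 is smooth, on an open set. For phi = psi this
   says that phi has open image. *)
Definition smooth_transition (R : realType) (X : Type) (n k : nat)
    (phi : chart R X n) (psi : chart R X k) : Prop :=
  forall x, cdom phi x -> cdom psi x -> exists F, local_rep id x phi psi F.

Definition chart_inj (R : realType) (X : Type) (n : nat) (phi : chart R X n) :
    Prop :=
  forall x y, cdom phi x -> cdom phi y -> cmap phi x = cmap phi y -> x = y.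

Section Manifolds.
Context {R : realType}.
Implicit Types X Y Z : charted R.

Definition chart_at X (x : X) (phi : chart R X (mdim X)) : Prop :=
  atlas phi /\ cdom phi x.

Definition mopen X (U : set X) : Prop :=
  forall phi : chart R X (mdim X),
    atlas phi -> open (cmap phi @` (U `&` cdom phi)).

Definition is_manifold X : Prop :=
  [/\ forall x : X, exists phi, chart_at x phi,
      forall phi : chart R X (mdim X), atlas phi -> chart_inj phi,
      forall phi psi : chart R X (mdim X),
        atlas phi -> atlas psi -> smooth_transition phi psi,
      forall x y : X, x <> y -> exists U V : set X,
        [/\ mopen U, mopen V, U x, V y & U `&` V = set0] &
      exists B : nat -> set X, (forall i, mopen (B i)) /\
        forall (U : set X) x, mopen U -> U x ->
          exists i, B i x /\ B i `<=` U].

Definition maximal_atlas X : set (chart R X (mdim X)) :=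
  [set psi | chart_inj psi /\
    forall phi, atlas phi -> smooth_transition phi psi /\
                             smooth_transition psi phi].

Definition smooth_at X Y (f : X -> Y) (x : X) : Prop :=
  exists phi psi F,
    [/\ chart_at x phi, chart_at (f x) psi & local_rep f x phi psi F].

Definition smooth X Y (f : X -> Y) : Prop := forall x, smooth_at f x.

Definition euclidean (n : nat) : charted R :=
  @Charted R 'rV[R]_n n [set Chart setT id].

Definition mprod X Y : charted R :=
  @Charted R (X * Y)%type (mdim X + mdim Y)
    [set chi | exists phi psi,
       [/\ atlas phi, atlas psi &
           chi = Chart [set p : X * Y | cdom phi p.1 /\ cdom psi p.2]
                       (fun p => row_mx (cmap phi p.1) (cmap psi p.2))]].

(* The [k]-dimensional embedded submanifold structure on [S], by slice charts:
   charts psi of X in which S is given by the vanishing of all coordinates of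
   index >= k, restricted to S. *)
Definition submfd X (S : set X) (k : nat) : charted R :=
  @Charted R {x : X | S x} k
    [set chi | exists psi : chart R X (mdim X),
       [/\ maximal_atlas psi, (k <= mdim X)%N,
           forall x, cdom psi x ->
             (S x <-> forall i : 'I_(mdim X), (k <= i)%N -> cmap psi x 0 i = 0),
           forall y, cdom chi y <-> cdom psi (sval y) &
           forall y (i : 'I_k) (j : 'I_(mdim X)), cdom chi y ->
             i = j :> nat -> cmap chi y 0 i = cmap psi (sval y) 0 j]].

(* Only used when [f] or [g] is a submersion, whence the dimension. *)
Definition fibre_prod X Y Z (f : X -> Z) (g : Y -> Z) : charted R :=
  @submfd (mprod X Y) [set p | f p.1 = g p.2] (mdim X + mdim Y - mdim Z).

Definition fpr1 X Y Z (f : X -> Z) (g : Y -> Z) (p : fibre_prod f g) : X :=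
  (sval p).1.
Definition fpr2 X Y Z (f : X -> Z) (g : Y -> Z) (p : fibre_prod f g) : Y :=
  (sval p).2.

(* The square  P -a-> X -f-> Z <-g- Y <-b- P  is a pullback of manifolds. *)
Definition is_fibre_product (P X Y Z : charted R) (a : P -> X) (b : P -> Y)
    (f : X -> Z) (g : Y -> Z) : Prop :=
  [/\ smooth a, smooth b, forall p, f (a p) = g (b p) &
      forall (T : charted R) (a' : T -> X) (b' : T -> Y), is_manifold T ->
        smooth a' -> smooth b' -> (forall z, f (a' z) = g (b' z)) ->
        exists! c : T -> P,
          [/\ smooth c, forall z, a (c z) = a' z & forall z, b (c z) = b' z]].

(** ** Tangent vectors *)

(* A tangent vector at [x] assigns to each chart at [x] a coordinate vector, in
   a way that transforms by the differentials of the transition maps; charts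
   not at [x] get the value 0, for uniqueness. *)
Definition tangent_compat X (x : X) :
    {pred (chart R X (mdim X) -> 'rV[R]_(mdim X))} :=
  fun v => `[< (forall phi, ~ chart_at x phi -> v phi = 0) /\
    forall phi psi F, chart_at x phi -> chart_at x psi ->
      local_rep id x phi psi F -> v psi = 'd F (cmap phi x) (v phi) >].

Lemma tangent_compat_submod_closed X (x : X) :
  submod_closed (@tangent_compat X x).
Proof.
split=> [|c v w /asboolP[v0 vD] /asboolP[w0 wD]]; apply/asboolP; split.
- by [].
- by move=> phi psi F _ _ _; rewrite linear0.
- move=> phi nphi; rewrite /GRing.add /= /GRing.scale /=.
  by rewrite v0 // w0 // scaler0 addr0.
- move=> phi psi F hphi hpsi hF; rewrite /GRing.add /= /GRing.scale /=.
  by rewrite (vD _ _ _ hphi hpsi hF) (wD _ _ _ hphi hpsi hF) linearP.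
Qed.

HB.instance Definition _ X (x : X) :=
  GRing.isSubmodClosed.Build _ _ (@tangent_compat X x)
    (tangent_compat_submod_closed x).

Record tangent X (x : X) := Tangent {
  tcoord :> chart R X (mdim X) -> 'rV[R]_(mdim X);
  _ : tcoord \in @tangent_compat X x }.

HB.instance Definition _ X (x : X) := [isSub for @tcoord X x].
HB.instance Definition _ X (x : X) := [Choice of tangent x by <:].
HB.instance Definition _ X (x : X) :=
  [SubChoice_isSubLmodule of tangent x by <:].

(* df_x v, the vector whose coordinates are the images of those of v under the
   differentials of the coordinate expressions of f. *)
Definition tmap X Y (f : X -> Y) (x : X) (v : tangent x) : tangent (f x) :=
  xget 0 [set w : tangent (f x) | forall phi psi F,
    chart_at x phi -> chart_at (f x) psi -> local_rep f x phi psi F ->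
    w psi = 'd F (cmap phi x) (v phi)].

Definition submersion X Y (f : X -> Y) : Prop :=
  smooth f /\ forall x (w : tangent (f x)), exists v : tangent x, tmap f v = w.

Definition surjective_submersion X Y (f : X -> Y) : Prop :=
  submersion f /\ forall y, exists x, f x = y.

(** * Vector bundles *)

Record vbundle X := VBundle {
  fib :> X -> lmodType R;
  vrank : nat;
  trivs : set (set X * (forall x, fib x -> 'rV[R]_vrank)) }.

Definition is_vbundle X (E : vbundle X) : Prop :=
  [/\ forall tau, trivs (v := E) tau -> mopen tau.1 /\
        forall x, tau.1 x -> linear (tau.2 x) /\ bijective (tau.2 x),
      forall x, exists2 tau, trivs (v := E) tau & tau.1 x &
      forall tau tau', trivs (v := E) tau -> trivs (v := E) tau' ->
        exists g : X -> 'M[R]_(vrank E),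
          (forall x, tau.1 x -> tau'.1 x ->
             @smooth_at X (euclidean (vrank E * vrank E))
               (fun y => mxvec (g y)) x) /\
          (forall x (e : E x), tau.1 x -> tau'.1 x ->
             tau'.2 x e = tau.2 x e *m g x)].

Definition total_space X (E : vbundle X) : charted R :=
  @Charted R {x : X & E x} (mdim X + vrank E)
    [set chi | exists phi tau,
       [/\ atlas phi, trivs (v := E) tau &
           chi = Chart
             [set e : {x : X & E x} | cdom phi (tag e) /\ tau.1 (tag e)]
             (fun e => row_mx (cmap phi (tag e)) (tau.2 (tag e) (tagged e)))]].

Definition point_in X (E : vbundle X) (x : X) (e : E x) : total_space E :=
  existT (fun x => E x : Type) x e.

Definition total_map X Y (E : vbundle X) (E' : vbundle Y) (f : X -> Y)
    (F : forall x, E x -> E' (f x)) : total_space E -> total_space E' :=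
  fun e => point_in (F (tag e) (tagged e)).

Definition tangent_bundle X : vbundle X :=
  @VBundle X (fun x => tangent x) (mdim X)
    [set tau | exists2 phi, atlas phi &
       tau = (cdom phi, fun x (v : tangent x) => v phi)].

Definition whitney_sum X (E E' : vbundle X) : vbundle X :=
  @VBundle X (fun x => (E x * E' x)%type) (vrank E + vrank E')
    [set tau | exists sigma sigma',
       [/\ trivs (v := E) sigma, trivs (v := E') sigma' &
           tau = (sigma.1 `&` sigma'.1,
                  fun x (e : E x * E' x) =>
                    row_mx (sigma.2 x e.1) (sigma'.2 x e.2))]].

(** ** 1-forms with values in a vector bundle *)

Definition is_form1 X (E : vbundle X) (theta : forall x : X, tangent x -> E x) :
    Prop :=
  (forall x, linear (theta x)) /\
  smooth (@total_map X X (tangent_bundle X) E id theta).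

(* F_x^-1, for a fibrewise isomorphism F. *)
Definition fibre_inv (V : lmodType R) (T : Type) (F : V -> T) (y : T) : V :=
  xget 0 [set e | F e = y].

Definition pullback1 X Y (E : vbundle X) (E' : vbundle Y) (f : X -> Y)
    (F : forall x, E x -> E' (f x)) (theta : forall y : Y, tangent y -> E' y) :
    forall x : X, tangent x -> E x :=
  fun x v => fibre_inv (F x) (theta (f x) (tmap f v)).

End Manifolds.

(** * Lie groupoids *)

Record gpd (R : realType) := Gpd {
  arrows : charted R;
  objects : charted R;
  gsrc : arrows -> objects;
  gtgt : arrows -> objects;
  gunit : objects -> arrows;
  ginv : arrows -> arrows;
  gmul : fibre_prod gsrc gtgt -> arrows }.

Section Groupoids.
Context {R : realType}.
Implicit Types G H : gpd R.

Definition comp_pairs G : charted R := fibre_prod (@gsrc R G) (@gtgt R G).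

Definition comp_pair G (g h : arrows G) (e : gsrc g = gtgt h) : comp_pairs G :=
  exist _ (g, h) e.

Definition is_groupoid G : Prop :=
  [/\ forall x : objects G, gsrc (gunit x) = x /\ gtgt (gunit x) = x,
      forall g : arrows G, gsrc (ginv g) = gtgt g /\ gtgt (ginv g) = gsrc g,
      forall p : comp_pairs G,
        gsrc (gmul p) = gsrc (fpr2 p) /\ gtgt (gmul p) = gtgt (fpr1 p),
      forall (g h k : arrows G) (egh : gsrc g = gtgt h) (ehk : gsrc h = gtgt k)
        (e : gsrc (gmul (comp_pair egh)) = gtgt k)
        (e' : gsrc g = gtgt (gmul (comp_pair ehk))),
        gmul (comp_pair e) = gmul (comp_pair e') &
      forall g : arrows G,
        [/\ forall e : gsrc g = gtgt (gunit (gsrc g)), gmul (comp_pair e) = g,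
            forall e : gsrc (gunit (gtgt g)) = gtgt g, gmul (comp_pair e) = g,
            forall e : gsrc g = gtgt (ginv g),
              gmul (comp_pair e) = gunit (gtgt g) &
            forall e : gsrc (ginv g) = gtgt g,
              gmul (comp_pair e) = gunit (gsrc g)]].

Definition is_lie_groupoid G : Prop :=
  [/\ is_manifold (arrows G) /\ is_manifold (objects G),
      is_groupoid G,
      submersion (@gsrc R G) /\ submersion (@gtgt R G),
      smooth (@gunit R G) /\ smooth (@ginv R G) &
      smooth (@gmul R G : comp_pairs G -> arrows G)].

Definition is_lie_groupoid_morphism H G (f1 : arrows H -> arrows G)
    (f0 : objects H -> objects G) : Prop :=
  [/\ smooth f1 /\ smooth f0,
      forall h, gsrc (f1 h) = f0 (gsrc h) /\ gtgt (f1 h) = f0 (gtgt h),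
      forall y, f1 (gunit y) = gunit (f0 y),
      forall h, f1 (ginv h) = ginv (f1 h) &
      forall (p : comp_pairs H) (q : comp_pairs G),
        fpr1 q = f1 (fpr1 p) -> fpr2 q = f1 (fpr2 p) ->
        f1 (gmul p) = gmul q].

Definition src_tgt G (g : arrows G) : mprod (objects G) (objects G) :=
  (gsrc g, gtgt g).

Definition is_morita_map H G (f1 : arrows H -> arrows G)
    (f0 : objects H -> objects G) : Prop :=
  [/\ is_lie_groupoid_morphism f1 f0,
      @is_fibre_product R (arrows H) (arrows G) (mprod (objects H) (objects H))
        (mprod (objects G) (objects G)) f1 (@src_tgt H) (@src_tgt G)
        (fun y => (f0 y.1, f0 y.2)) &
      surjective_submersion
        (fun p : fibre_prod (@gsrc R G) f0 => gtgt (fpr1 p))].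

End Groupoids.

(** * VB-groupoids *)

(* The structure maps of V are given fibrewise over those of [base]. The fibre
   of V^(2) over (g,h) consists of the pairs (l,l') in V_g x V_h with
   s(l) = t(l'), an equality in the total space of V_M. *)
Definition comp_fibre (R : realType) (G : gpd R) (V : vbundle (arrows G))
    (VM : vbundle (objects G)) (vs : forall g : arrows G, V g -> VM (gsrc g))
    (vt : forall g : arrows G, V g -> VM (gtgt g)) (p : comp_pairs G) :
    set (V (fpr1 p) * V (fpr2 p)) :=
  [set l | point_in (vs _ l.1) = point_in (vt _ l.2)].

Record vbg (R : realType) := VBG {
  base : gpd R;
  varr : vbundle (arrows base);
  vobj : vbundle (objects base);
  vsrc : forall g : arrows base, varr g -> vobj (gsrc g);
  vtgt : forall g : arrows base, varr g -> vobj (gtgt g);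
  vunt : forall x : objects base, vobj x -> varr (gunit x);
  vinv : forall g : arrows base, varr g -> varr (ginv g);
  vmul : forall p : comp_pairs base,
    {l | comp_fibre vsrc vtgt (p := p) l} -> varr (gmul p) }.

Section VBGroupoids.
Context {R : realType}.
Implicit Types V W L : vbg R.

Definition vfibre2 V (p : comp_pairs (base V)) :
    set (varr V (fpr1 p) * varr V (fpr2 p)) :=
  comp_fibre (@vsrc R V) (@vtgt R V) (p := p).

(* The groupoid V => V_M. *)
Definition vtotal V : gpd R :=
  let vs := total_map (@vsrc R V) in
  let vt := total_map (@vtgt R V) in
  @Gpd R (total_space (varr V)) (total_space (vobj V)) vs vt
    (total_map (@vunt R V)) (total_map (@vinv R V))
    (fun p : fibre_prod vs vt =>
       let q := comp_pair (congr1 (@tag _ _) (svalP p)) in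
       point_in (@vmul R V q
         (exist _ (tagged (fpr1 p), tagged (fpr2 p)) (svalP p)))).

Definition is_vbg V : Prop :=
  [/\ is_lie_groupoid (base V) /\ is_lie_groupoid (vtotal V),
      is_vbundle (varr V) /\ is_vbundle (vobj V),
      forall g, linear (@vsrc R V g) /\ linear (@vtgt R V g),
      (forall x, linear (@vunt R V x)) /\ (forall g, linear (@vinv R V g)) &
      forall (p : comp_pairs (base V)) (a : R)
        (l l' l'' : {l | vfibre2 (p := p) l}),
        sval l'' = a *: sval l + sval l' ->
        vmul l'' = a *: vmul l + vmul l'].

Definition is_lbg L : Prop :=
  [/\ is_vbg L, vrank (varr L) = 1%N & vrank (vobj L) = 1%N].

Definition is_vbg_morphism W V (f1 : arrows (base W) -> arrows (base V))
    (f0 : objects (base W) -> objects (base V))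
    (F1 : forall h, varr W h -> varr V (f1 h))
    (F0 : forall y, vobj W y -> vobj V (f0 y)) : Prop :=
  [/\ is_lie_groupoid_morphism f1 f0,
      @is_lie_groupoid_morphism R (vtotal W) (vtotal V)
        (total_map F1) (total_map F0),
      forall h, linear (F1 h) &
      forall y, linear (F0 y)].

Definition is_vb_morita_map W V (f1 : arrows (base W) -> arrows (base V))
    (f0 : objects (base W) -> objects (base V))
    (F1 : forall h, varr W h -> varr V (f1 h))
    (F0 : forall y, vobj W y -> vobj V (f0 y)) : Prop :=
  is_vbg_morphism F1 F0 /\
  @is_morita_map R (vtotal W) (vtotal V) (total_map F1) (total_map F0).

(** ** The operator ∂ *)

Section Coboundary.
Variable L : vbg R.
Let G := base L.

Definition coboundary0 (alpha : forall x : objects G, tangent x -> vobj L x) :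
    forall g : arrows G, tangent g -> varr L g :=
  fun g v => pullback1 (@vsrc R L) alpha v - pullback1 (@vtgt R L) alpha v.

(* The inverse of a fibrewise isomorphism F from L^(2) to another bundle, with
   the fibre of L^(2) over (g,h) regarded as a subspace of L_g x L_h. *)
Definition fibre2_inv (p : comp_pairs G) (T : Type)
    (F : {l | vfibre2 (p := p) l} -> T) (y : T) :
    (varr L (fpr1 p) * varr L (fpr2 p))%type :=
  xget 0 [set l | exists hl, F (exist _ l hl) = y].

Definition coboundary1 (theta : forall g : arrows G, tangent g -> varr L g) :
    forall p : comp_pairs G, tangent p ->
      (varr L (fpr1 p) * varr L (fpr2 p))%type :=
  fun p xi =>
    fibre2_inv (fun l : {l | vfibre2 (p := p) l} => (sval l).2)
      (theta _ (tmap (@fpr2 _ _ _ _ _ _) xi))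
    - fibre2_inv (@vmul R L p) (theta _ (tmap (@gmul R G) xi))
    + fibre2_inv (fun l : {l | vfibre2 (p := p) l} => (sval l).1)
        (theta _ (tmap (@fpr1 _ _ _ _ _ _) xi)).

Definition multiplicative_form
    (theta : forall g : arrows G, tangent g -> varr L g) : Prop :=
  forall p (xi : tangent p), coboundary1 theta xi = 0.

End Coboundary.

(** * The Morita kernel *)

(* vv' = dm(xi), for the vector xi tangent to the manifold of composable pairs
   that corresponds to (v,v') under T(G^(2)) = (TG)^(2). *)
Definition tangent_mul (G : gpd R) (p : comp_pairs G)
    (v : tangent (fpr1 p)) (v' : tangent (fpr2 p)) : tangent (gmul p) :=
  tmap (@gmul R G)
    (xget 0 [set xi : tangent p | tmap (@fpr1 _ _ _ _ _ _) xi = v /\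
                                  tmap (@fpr2 _ _ _ _ _ _) xi = v']).

Section MoritaKernel.
Variables (L : vbg R)
  (theta : forall g : arrows (base L), tangent g -> varr L g).
Let G := base L.
Let V := whitney_sum (tangent_bundle (arrows G)) (varr L).
Let VM := whitney_sum (tangent_bundle (objects G)) (vobj L).

(* s_g^-1, with argument in the total space of L_M: the source of g need only
   equal the base point of the argument propositionally. *)
Definition src_inv (g : arrows G) (y : total_space (vobj L)) : varr L g :=
  fibre_inv (fun l => point_in (@vsrc R L g l)) y.

Definition mk_src (g : arrows G) (a : V g) : VM (gsrc g) :=
  (tmap (@gsrc R G) a.1, vsrc a.2).
Definition mk_tgt (g : arrows G) (a : V g) : VM (gtgt g) :=
  (tmap (@gtgt R G) a.1, vtgt (a.2 + theta a.1)).
Definition mk_unt (x : objects G) (a : VM x) : V (gunit x) :=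
  (tmap (@gunit R G) a.1, vunt a.2).
Definition mk_inv (g : arrows G) (a : V g) : V (ginv g) :=
  (tmap (@ginv R G) a.1, src_inv (ginv g) (point_in (vtgt (a.2 + theta a.1)))).
Definition mk_mul (p : comp_pairs G)
    (l : {l | comp_fibre mk_src mk_tgt (p := p) l}) : V (gmul p) :=
  let: (a, a') := sval l in
  (tangent_mul a.1 a'.1, src_inv (gmul p) (point_in (vsrc a'.2))).

Definition morita_kernel : vbg R :=
  @VBG R G V VM mk_src mk_tgt mk_unt mk_inv mk_mul.

End MoritaKernel.

(** ** The map A, over the identity of G => M *)

Section ComparisonMap.
Variables (L : vbg R)
  (theta theta' : forall g : arrows (base L), tangent g -> varr L g)
  (alpha : forall x : objects (base L), tangent x -> vobj L x).

Definition comparison_arr (g : arrows (base L))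
    (a : varr (morita_kernel theta) g) : varr (morita_kernel theta') g :=
  (a.1, a.2 + pullback1 (@vsrc R L) alpha a.1).

Definition comparison_obj (x : objects (base L))
    (a : vobj (morita_kernel theta) x) : vobj (morita_kernel theta') x :=
  (a.1, a.2 + alpha a.1).

End ComparisonMap.

End VBGroupoids.

(* Main.v *)
Require Import Defs.
From HB Require Import structures.
From mathcomp Require Import all_boot all_order all_algebra.
From mathcomp Require Import all_classical all_reals all_analysis.

(** Over the identity of G => M the map A is a shear (v, l) |-> (v, l + beta v),
    where beta is s^*alpha on arrows and alpha on objects. It is therefore a
    diffeomorphism on arrows and on objects, its inverse being the shear along
    - beta ([shearK], [comparison_smooth]). This gives both conditions on a Morita
    map. The square in the first one is a pullback because its two horizontal maps
    are invertible ([comparison_fibre_product]). In the second one, the manifold of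
    pairs (g, y) with s(g) = A(y) is the graph of A^-1 o s over the arrows, and the
    map to be considered becomes the target map of the Morita kernel
    ([graph_submersion]). That map is a submersion because it is fibrewise onto
    over the submersion t ([total_map_submersion], [mk_tgt_submersion]).

    It remains that A is a groupoid morphism. Compatibility with the target uses
    theta - theta' = s^*alpha - t^*alpha ([cohom_tgt]). For units, inverses and
    products, both sides have L-components in one fibre L_g, and it is enough to
    compare their images under s_g. This turns the claims into ds(du v) = v,
    ds(v^-1) = dt v and ds(vv') = ds(v'), which follow from the chain rule. Two
    facts enter here. The maps s_g and t_g are isomorphisms, by cancellation in
    the groupoid L and equality of ranks ([vsrc_inj], [vtgt_inj]). And every pair
    (v, v') with ds(v) = dt(v') is tangent to the manifold of composable pairs, by
    a count of dimensions ([tangent_fibre_prod]), so that vv' is meaningful.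

    Smoothness of all these maps of total spaces is checked in charts and
    trivializations. The tangent functor, direct sums, sums and compositions
    preserve it. For s^*alpha = s^-1 o alpha o ds one divides by the nowhere
    vanishing function that expresses s on the line bundles
    ([smooth_bundle_div]). *)

Set Implicit Arguments.
Unset Strict Implicit.
Unset Printing Implicit Defensive.
Import Order.TTheory GRing.Theory Num.Theory.
Import numFieldNormedType.Exports.
Local Open Scope classical_set_scope.
Local Open Scope ring_scope.

(** * Differentials *)

Section Differentials.
Context {R : realType}.

(** The differential depends on the germ only. As smoothness is defined by
    iterating pointwise differentials, this is what makes it a local notion. *)
Lemma is_diff_near (V W : normedModType R) (f g : V -> W) (x : V) :
  differentiable f x -> (\forall y \near x, f y = g y) ->
  is_diff x g ('d f x).
Proof.
move=> df fg.
have fgx : f x = g x by exact: nbhs_singleton fg.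
have H : g \o shift x = cst (g x) + 'd f x +o_ 0 id.
  apply/eqaddoP => e e0.
  have /eqaddoP/(_ e e0) := diff_locally df.
  have fg' : \forall h \near (0 : V), f (h + x) = g (h + x).
    by move/nbhs0P : fg; apply: filterS => h; rewrite addrC.
  by apply: filterS2 fg' => h /= fgh; rewrite !fctE /= fgh fgx.
have E := diff_unique (diff_continuous df) H.
have dg : differentiable g x.
  by apply/diff_locallyP; rewrite E; split => //; exact: diff_continuous df.
exact: DiffDef dg E.
Qed.

Lemma is_diffE (V W : normedModType R) (f df : V -> W) (x : V) :
  is_diff x f df -> forall v, 'd f x v = df v.
Proof. by case=> _ E v; rewrite -[df]E. Qed.

Lemma linear_rV_continuous n (W : normedModType R)
    (f : {linear 'rV[R]_n -> W}) : continuous f.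
Proof.
have E : f = \sum_(i < n) (fun v : 'rV_n => v 0 i *: f (delta_mx 0 i))
    :> ('rV_n -> W).
  apply/funext => v; rewrite fct_sumE [in LHS](row_sum_delta v) linear_sum.
  by apply: eq_bigr => i _; rewrite linearZ.
move=> x; apply: differentiable_continuous; rewrite E.
apply: differentiable_sum => i.
apply: (differentiableZl (k := fun v : 'rV[R]_n => v 0 i)).
exact: differentiable_coord.
Qed.

Lemma scale_bilinear (V : normedModType R) :
  bilinear_for (GRing.Scale.Law.clone _ _ *:%R _)
    (GRing.Scale.Law.clone _ _ *:%R _) (fun (a : R) (v : V) => a *: v).
Proof.
split=> [u'|u] a x y /=; first by rewrite scalerDl scalerA.
by rewrite scalerDr !scalerA mulrC.
Qed.

(** The Leibniz rule, as the chain rule for the continuous bilinear map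
    (a, v) |-> a v. *)
Lemma is_diff_scale (U V : normedModType R) (k dk : U -> R) (f df : U -> V)
    (x : U) : is_diff x k dk -> is_diff x f df ->
  is_diff x (fun y => k y *: f y) (fun v => k x *: df v + dk v *: f x).
Proof.
move=> Dk Df.
pose b (a : R) (v : V) := a *: v.
pose B : {bilinear R -> V -> V} :=
  HB.pack b (bilinear_isBilinear.Build R R V V _ _ b (@scale_bilinear V)).
have Bc : continuous (fun p : R * V => B p.1 p.2) by exact: scale_continuous.
have DB : is_diff (k x, f x) (fun p : R * V => B p.1 p.2)
    (fun q => B (k x) q.2 + B q.1 (f x)).
  exact: DiffDef (differentiable_bilin _ Bc) (diff_bilin _ Bc).
exact: is_diff_comp (is_diff_pair Dk Df) DB.
Qed.

Lemma diff_linear n (W : normedModType R) (f : {linear 'rV[R]_n -> W}) x :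
  'd f x = f :> (_ -> _).
Proof. exact/diff_lin/linear_rV_continuous. Qed.

Lemma differentiable_linear n (W : normedModType R)
    (f : {linear 'rV[R]_n -> W}) x : differentiable f x.
Proof. exact/linear_differentiable/linear_rV_continuous. Qed.

End Differentials.

(** * Closure properties of smooth functions *)

Section SmoothOn.
Context {R : realType}.

Lemma of_class_C_le n k r r' W (F : 'rV[R]_n -> 'rV[R]_k) :
  (r' <= r)%N -> of_class_C r W F -> of_class_C r' W F.
Proof.
suff S : forall r (F : 'rV[R]_n -> 'rV[R]_k),
    of_class_C r.+1 W F -> of_class_C r W F.
  elim: r => [|r IH]; first by rewrite leqn0 => /eqP ->.
  by rewrite leq_eqVlt => /orP[/eqP -> //|/IH {}IH /S].
elim=> [{}F [dF _] x Wx|s IH {}F [dF dF']].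
  exact: differentiable_continuous (dF x Wx).
by split => // v; exact: IH (dF' v).
Qed.

Lemma of_class_C_eq n k r W (F G : 'rV[R]_n -> 'rV[R]_k) :
  open W -> (forall x, W x -> F x = G x) -> of_class_C r W F -> of_class_C r W G.
Proof.
move=> oW; elim: r F G => [|r IH] F G FG.
  move=> cF x Wx.
  have nFG : {near nbhs x, F =1 G}.
    by apply: filterS (open_nbhs_nbhs (conj oW Wx)) => y; exact: FG.
  have := cF x Wx; rewrite /prop_for /continuous_at (FG x Wx) => {}cF.
  exact: cvg_trans (near_eq_cvg nFG) cF.
move=> [dF dF'].
have dG x : W x -> is_diff x G ('d F x).
  move=> Wx; apply: is_diff_near (dF x Wx) _.
  by apply: filterS (open_nbhs_nbhs (conj oW Wx)) => y; exact: FG.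
split=> [x Wx|v]; first by have [] := dG x Wx.
apply: IH (dF' v) => x Wx.
exact/esym/(is_diffE (dG x Wx)).
Qed.

Lemma of_class_C_subset n k r W V (F : 'rV[R]_n -> 'rV[R]_k) :
  V `<=` W -> of_class_C r W F -> of_class_C r V F.
Proof.
move=> VW; elim: r F => [F cF x /VW|r IH F [dF dF']]; first exact: cF.
by split=> [x /VW /dF //|v]; exact/IH/dF'.
Qed.

Lemma of_class_C_cst n k r W (c : 'rV[R]_k) :
  of_class_C r W (fun _ : 'rV[R]_n => c).
Proof.
elim: r c => [|r IH] c /=; first by move=> x _; exact: cst_continuous.
split=> [x _|v]; first exact: differentiable_cst.
have -> : (fun x : 'rV[R]_n => 'd (fun _ => c) x v) = fun _ => 0.
  by apply/funext => x; rewrite (diff_cst c).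
exact: IH.
Qed.

Lemma of_class_C_linear n k r W (f : {linear 'rV[R]_n -> 'rV[R]_k}) :
  of_class_C r W f.
Proof.
case: r => [x _|r]; first exact: linear_rV_continuous.
split=> [x _|v]; first exact: differentiable_linear.
have -> : (fun x => 'd f x v) = fun _ => f v.
  by apply/funext => x; rewrite diff_linear.
exact: of_class_C_cst.
Qed.

Lemma of_class_CD n k r W (F G : 'rV[R]_n -> 'rV[R]_k) : open W ->
  of_class_C r W F -> of_class_C r W G -> of_class_C r W (fun x => F x + G x).
Proof.
move=> oW; elim: r F G => [|r IH] F G.
  by move=> cF cG x Wx; exact: cvgD (cF x Wx) (cG x Wx).
move=> [dF dF'] [dG dG']; split=> [x Wx|v].
  exact: differentiableD (dF x Wx) (dG x Wx).
apply: of_class_C_eq oW _ (IH _ _ (dF' v) (dG' v)) => x Wx.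
exact/esym/(is_diffE (is_diffD (differentiableP (dF x Wx))
                                (differentiableP (dG x Wx)))).
Qed.

Lemma of_class_C_sum n k m r W (F : 'I_m -> 'rV[R]_n -> 'rV[R]_k) : open W ->
  (forall i, of_class_C r W (F i)) -> of_class_C r W (fun x => \sum_i F i x).
Proof.
move=> oW cF; have -> : (fun x => \sum_i F i x) = \sum_i F i.
  by apply/funext => x; rewrite fct_sumE.
by elim/big_ind : _ => [|f g|//]; [exact: of_class_C_cst|exact: of_class_CD].
Qed.

Lemma is_diff_entry n m (F : 'rV[R]_n -> 'rV[R]_m) (j : 'I_m) x :
  differentiable F x ->
  is_diff x (fun y => F y 0 j) (fun v => 'd F x v 0 j).
Proof.
move=> dF; pose c (v : 'rV[R]_m) := v 0 j.
have cl : linear c by move=> a u v; rewrite /c !mxE.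
pose C : {linear 'rV[R]_m -> R} := HB.pack c (GRing.isLinear.Build _ _ _ _ c cl).
have DC : is_diff (F x) C C.
  exact: DiffDef (differentiable_linear C _) (diff_linear C _).
exact: is_diff_comp (differentiableP dF) DC.
Qed.

(** A scalar function is represented as an entry of a vector-valued one, so
    that the classes C^r of vector-valued functions suffice throughout. *)
Lemma of_class_CZ n k m r W (F : 'rV[R]_n -> 'rV[R]_m) (j : 'I_m)
    (G : 'rV[R]_n -> 'rV[R]_k) : open W ->
  of_class_C r W F -> of_class_C r W G ->
  of_class_C r W (fun x => F x 0 j *: G x).
Proof.
move=> oW; elim: r F G => [|r IH] F G.
  move=> cF cG x Wx; apply: cvgZ (cG x Wx).
  exact: (continuous_comp (cF x Wx) (@coord_continuous _ _ _ 0 j _)).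
move=> CF CG.
have CF' := of_class_C_le (leqnSn r) CF; have CG' := of_class_C_le (leqnSn r) CG.
case: CF CG => [dF dF'] [dG dG'].
have D x : W x -> is_diff x (fun x => F x 0 j *: G x)
    (fun v => F x 0 j *: 'd G x v + 'd F x v 0 j *: G x).
  move=> Wx.
  exact: is_diff_scale (is_diff_entry j (dF x Wx)) (differentiableP (dG x Wx)).
split=> [x Wx|v]; first by have [] := D x Wx.
apply: of_class_C_eq oW _ (of_class_CD oW (IH _ _ CF' (dG' v)) (IH _ _ (dF' v) CG')).
by move=> x Wx; exact/esym/(is_diffE (D x Wx)).
Qed.

(** By the chain rule the derivative of G o F along v is the sum of the
    (dF v)_j times (d_j G) o F, so that the induction on r rests on the product
    rule and on the case of a composition of lower class. *)
Lemma of_class_C_comp n m k r W V (F : 'rV[R]_n -> 'rV[R]_m)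
    (G : 'rV[R]_m -> 'rV[R]_k) : open W ->
  (forall x, W x -> V (F x)) ->
  of_class_C r W F -> of_class_C r V G -> of_class_C r W (G \o F).
Proof.
move=> oW WV; elim: r F G WV => [|r IH] F G WV.
  by move=> cF cG x Wx; exact: continuous_comp (cF x Wx) (cG _ (WV _ Wx)).
move=> CF; have CF' := of_class_C_le (leqnSn r) CF.
case: CF => [dF dF'] [dG dG'].
split=> [x Wx|v]; first exact: differentiable_comp (dF x Wx) (dG _ (WV x Wx)).
apply: (of_class_C_eq (F := fun x =>
  \sum_j ('d F x v) 0 j *: ((fun y => 'd G y (delta_mx 0 j)) \o F) x) oW).
  move=> x Wx; rewrite (diff_comp (dF x Wx) (dG _ (WV x Wx))) /=.
  rewrite [in RHS](row_sum_delta ('d F x v)) linear_sum.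
  by apply: eq_bigr => j _; rewrite linearZ.
apply: (of_class_C_sum oW) => j.
apply: (of_class_CZ (F := fun x => 'd F x v) j oW) => //.
  exact: dF'.
exact: (IH _ _ WV CF' (dG' (delta_mx 0 j))).
Qed.

(** The derivative - F' / F^2 of 1 / F is a polynomial in F' and 1 / F, which
    closes the induction on r. *)
Lemma of_class_CV n m r W (F : 'rV[R]_n -> 'rV[R]_m) (j : 'I_m) : open W ->
  (forall x, W x -> F x 0 j != 0) -> of_class_C r W F ->
  of_class_C r W (fun x => const_mx (F x 0 j)^-1 : 'rV[R]_1).
Proof.
move=> oW F0.
have scE (a : R) : const_mx a = a *: (const_mx 1 : 'rV[R]_1).
  by apply/rowP => i; rewrite !mxE mulr1.
have D x : W x -> differentiable F x -> is_diff x
    (fun x => const_mx (F x 0 j)^-1 : 'rV[R]_1)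
    (fun v => - ('d F x v 0 j *: ((F x 0 j)^-1 *: (const_mx (F x 0 j)^-1)))).
  move=> Wx dF; have [ej Ej] := is_diff_entry j dF.
  have -> : (fun x => const_mx (F x 0 j)^-1 : 'rV[R]_1) =
    fun x => (F x 0 j)^-1 *: const_mx 1 by apply/funext => y; rewrite scE.
  have dV := differentiableV ej (F0 x Wx).
  apply: DiffDef; first exact: differentiableZl.
  rewrite diffZl// diffV//; last exact: F0.
  apply/funext => v /=; rewrite Ej (scE (F x 0 j)^-1) !scalerA -scaleNr.
  by congr (_ *: _); rewrite exprSr expr1 invfM /GRing.scale /= mulNr mulrC mulrA.
elim: r => [|r IH] CF.
  move=> x Wx; have -> : (fun x => const_mx (F x 0 j)^-1 : 'rV[R]_1) =
    fun x => (F x 0 j)^-1 *: const_mx 1 by apply/funext => y; rewrite scE.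
  have cV : (F y 0 j)^-1 @[y --> x] --> (F x 0 j)^-1.
    have cE : F y 0 j @[y --> x] --> F x 0 j.
      exact: (continuous_comp (CF x Wx) (@coord_continuous _ _ _ 0 j _)).
    exact: (cvgV (F0 x Wx) cE).
  exact: (cvgZ cV (cvg_cst _)).
have {}IH := IH (of_class_C_le (leqnSn r) CF).
case: CF => dF dF'.
split=> [x Wx|v]; first by have [] := D x Wx (dF x Wx).
pose opp := (fun u : 'rV[R]_1 => -1 *: u).
apply: (of_class_C_eq (F := fun x => opp ('d F x v 0 j *:
    ((const_mx (F x 0 j)^-1 : 'rV[R]_1) 0 0 *:
      (const_mx (F x 0 j)^-1 : 'rV[R]_1)))) oW).
  by move=> x Wx; rewrite (is_diffE (D x Wx (dF x Wx))) /opp scaleN1r mxE.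
pose Opp : {linear 'rV[R]_1 -> 'rV[R]_1} := *:%R (-1).
apply: (of_class_C_comp oW (V := setT) (G := Opp)) => //; last first.
  exact: of_class_C_linear.
apply: (of_class_CZ (F := fun x => 'd F x v) j oW).
  exact: dF'.
exact: (of_class_CZ (F := fun x => const_mx (F x 0 j)^-1 : 'rV[R]_1) 0 oW).
Qed.

End SmoothOn.

(** * Local representatives in charts *)

Section LocalReps.
Context {R : realType}.

(** Fibrewise linearity is assumed of bare functions; this turns it into the
    structure to which the theory of linear maps applies. *)
Lemma linear_bundle (U V : lmodType R) (f : U -> V) :
  linear f -> exists g : {linear U -> V}, g = f :> (U -> V).
Proof.
move=> lf.
pose g : {linear U -> V} := HB.pack f (GRing.isLinear.Build _ _ _ _ f lf).
by exists g.
Qed.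

(** With the identity chart, functions with values in a coordinate space are
    an instance of maps between charted spaces, and compose like them. *)
Definition id_chart k : chart R 'rV[R]_k k := Chart setT id.

Definition chart_smooth (X : Type) n k (phi : chart R X n) (x : X)
    (f : X -> 'rV[R]_k) : Prop :=
  exists F, local_rep f x phi (id_chart k) F.

(** Validity of P near x, tested in the coordinates phi; like a local
    representative, it comes with a neighbourhood of phi(x) that lies in the
    image of phi. *)
Definition chart_near (X : Type) n (phi : chart R X n) (x : X) (P : set X) :
    Prop :=
  exists W : set 'rV[R]_n, [/\ open W, W (cmap phi x),
    W `<=` cmap phi @` cdom phi &
    forall z, cdom phi z -> W (cmap phi z) -> P z].

Lemma open_preimage_within n k (W : set 'rV[R]_n) (V : set 'rV[R]_k) F :
  open W -> open V -> of_class_C 0 W F -> open (W `&` F @^-1` V).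
Proof.
move=> oW oV cF; rewrite openE => x [Wx Vx]; apply: filterI.
  exact: open_nbhs_nbhs (conj oW Wx).
exact: (cF x Wx) (open_nbhs_nbhs (conj oV Vx)).
Qed.

Section Generic.
Context {X : Type} {n : nat}.
Implicit Types (phi : chart R X n) (x : X).

Lemma chart_nearS phi x (P Q : set X) :
  P `<=` Q -> chart_near phi x P -> chart_near phi x Q.
Proof.
move=> PQ [W [oW Wx Wi WP]]; exists W; split=> // z hz Wz.
exact/PQ/WP.
Qed.

Lemma chart_nearI phi x (P Q : set X) :
  chart_near phi x P -> chart_near phi x Q -> chart_near phi x (P `&` Q).
Proof.
move=> [W [oW Wx Wi WP]] [V [oV Vx Vi VQ]]; exists (W `&` V); split=> //.
- exact: openI.
- by move=> y [/Wi].
- by move=> z hz [Wz Vz]; split; [exact: WP|exact: VQ].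
Qed.

Lemma local_rep_near Y k (f : X -> Y) x phi (psi : chart R Y k) F :
  local_rep f x phi psi F ->
  chart_near phi x (f @^-1` cdom psi).
Proof.
by move=> [W [oW Wx Wi sF WF]]; exists W; split=> // z hz /(WF z hz)[].
Qed.

Lemma local_rep_eq Y k (f g : X -> Y) x phi (psi : chart R Y k) F :
  chart_near phi x (fun z => f z = g z) ->
  local_rep f x phi psi F -> local_rep g x phi psi F.
Proof.
move=> [W [oW Wx Wi WP]] [V [oV Vx Vi sF VF]]; exists (W `&` V); split=> //.
- exact: openI.
- by move=> y [/Wi].
- by move=> r; apply: of_class_C_subset (sF r) => y [].
- by move=> z hz [Wz Vz]; rewrite -(WP z hz Wz); exact: VF.
Qed.

Lemma local_rep_id phi x : chart_near phi x setT -> local_rep id x phi phi id.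
Proof.
move=> [W [oW Wx Wi _]]; exists W; split=> // r.
exact: (@of_class_C_linear R n n r W (@idfun 'rV[R]_n)).
Qed.

Lemma local_rep_chart_smooth Y k (f : X -> Y) x phi (psi : chart R Y k) F :
  local_rep f x phi psi F -> local_rep (cmap psi \o f) x phi (id_chart k) F.
Proof.
by move=> [W [oW Wx Wi sF WF]]; exists W; split=> // z hz /(WF z hz)[].
Qed.

Lemma local_rep_intro Y k (f : X -> Y) x phi (psi : chart R Y k) :
  chart_near phi x (f @^-1` cdom psi) -> chart_smooth phi x (cmap psi \o f) ->
  exists F, local_rep f x phi psi F.
Proof.
move=> [W [oW Wx Wi WP]] [F [V [oV Vx Vi sF VF]]]; exists F, (W `&` V); split.
- exact: openI.
- by [].
- by move=> y [/Wi].
- by move=> r; apply: of_class_C_subset (sF r) => y [].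
- by move=> z hz [Wz Vz]; split; [exact: WP|have [] := VF z hz Vz].
Qed.

Lemma local_rep_comp Y Z k l (f : X -> Y) (g : Y -> Z) x phi
    (psi : chart R Y k) (chi : chart R Z l) F G :
  cdom phi x -> local_rep f x phi psi F -> local_rep g (f x) psi chi G ->
  local_rep (g \o f) x phi chi (G \o F).
Proof.
move=> hx [W [oW Wx Wi sF WF]] [V [oV Vx Vi sG VG]].
exists (W `&` F @^-1` V); split.
- exact: open_preimage_within (sF 0%N).
- by split => //=; have [_ <-] := WF x hx Wx.
- by move=> y [/Wi].
- move=> r; apply: (of_class_C_comp (V := V)) (sG r).
  + exact: open_preimage_within (sF 0%N).
  + by move=> z [].
  + by apply: of_class_C_subset (sF r) => y [].
- move=> z hz [Wz Vz]; have [hf Ef] := WF z hz Wz.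
  by rewrite /= -Ef; apply: VG; rewrite ?Ef.
Qed.

Lemma chart_near_comp Y k (f : X -> Y) x phi (psi : chart R Y k) F P :
  cdom phi x -> local_rep f x phi psi F -> chart_near psi (f x) P ->
  chart_near phi x (f @^-1` P).
Proof.
move=> hx [W [oW Wx Wi sF WF]] [V [oV Vx Vi VP]].
exists (W `&` F @^-1` V); split.
- exact: open_preimage_within (sF 0%N).
- by split => //=; have [_ <-] := WF x hx Wx.
- by move=> y [/Wi].
- move=> z hz [Wz Vz]; have [hf Ef] := WF z hz Wz.
  by apply: VP; rewrite ?Ef.
Qed.

Lemma chart_smooth_comp Y k l (f : X -> Y) (g : Y -> 'rV[R]_l) x phi
    (psi : chart R Y k) F :
  cdom phi x -> local_rep f x phi psi F -> chart_smooth psi (f x) g ->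
  chart_smooth phi x (g \o f).
Proof.
by move=> hx hF [G hG]; exists (G \o F); exact: local_rep_comp hF hG.
Qed.

Lemma chart_smooth_eq k phi x (f g : X -> 'rV[R]_k) :
  chart_near phi x (fun z => f z = g z) ->
  chart_smooth phi x f -> chart_smooth phi x g.
Proof. by move=> fg [F hF]; exists F; exact: local_rep_eq hF. Qed.

Lemma chart_smooth_post k l phi x (f : X -> 'rV[R]_k) V
    (G : 'rV[R]_k -> 'rV[R]_l) :
  cdom phi x -> open V -> V (f x) -> smooth_on V G ->
  chart_smooth phi x f -> chart_smooth phi x (G \o f).
Proof.
move=> hx oV Vx sG [F hF]; apply: (chart_smooth_comp hx hF).
by exists G, V; split=> // y Vy; exists y.
Qed.

Lemma chart_smooth_cst k phi x (c : 'rV[R]_k) :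
  chart_near phi x setT -> chart_smooth phi x (fun=> c).
Proof.
move=> [W [oW Wx Wi _]]; exists (fun=> c), W; split=> // r.
exact: of_class_C_cst.
Qed.

Lemma chart_smooth_linear k l (L : 'rV[R]_k -> 'rV[R]_l) phi x
    (f : X -> 'rV[R]_k) :
  linear L -> cdom phi x -> chart_smooth phi x f ->
  chart_smooth phi x (L \o f).
Proof.
move=> /linear_bundle[g <-] hx; apply: (chart_smooth_post (V := setT)) => //.
  exact: openT.
by move=> r; exact: of_class_C_linear.
Qed.

Lemma chart_smooth_map2 k l m phi x (f : X -> 'rV[R]_k) (g : X -> 'rV[R]_l)
    (op : 'rV[R]_k -> 'rV[R]_l -> 'rV[R]_m) :
  (forall r W (F : 'rV[R]_n -> _) G, open W -> of_class_C r W F -> of_class_C r W G ->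
    of_class_C r W (fun y => op (F y) (G y))) ->
  chart_smooth phi x f -> chart_smooth phi x g ->
  chart_smooth phi x (fun z => op (f z) (g z)).
Proof.
move=> opC [F [W [oW Wx Wi sF WF]]] [G [V [oV Vx Vi sG VG]]].
have oWV := openI oW oV.
exists (fun y => op (F y) (G y)), (W `&` V); split=> //.
- by move=> y [/Wi].
- move=> r; apply: opC => //.
    by apply: of_class_C_subset (sF r) => y [].
  by apply: of_class_C_subset (sG r) => y [].
- move=> z hz [Wz Vz]; split=> //.
  by have [_ /= ->] := WF z hz Wz; have [_ /= ->] := VG z hz Vz.
Qed.

Lemma chart_smoothD k phi x (f g : X -> 'rV[R]_k) :
  chart_smooth phi x f -> chart_smooth phi x g ->
  chart_smooth phi x (fun z => f z + g z).
Proof.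
by apply: (chart_smooth_map2 (op := +%R)) => r W F G; exact: of_class_CD.
Qed.

Lemma chart_smoothZ k l phi x (f : X -> 'rV[R]_l) (j : 'I_l)
    (g : X -> 'rV[R]_k) :
  chart_smooth phi x f -> chart_smooth phi x g ->
  chart_smooth phi x (fun z => f z 0 j *: g z).
Proof.
by apply: (chart_smooth_map2 (op := fun u v => u 0 j *: v)) => r W F G;
  exact: of_class_CZ.
Qed.

Lemma chart_smooth_sum k m phi x (f : 'I_m -> X -> 'rV[R]_k) :
  chart_near phi x setT ->
  (forall i, chart_smooth phi x (f i)) ->
  chart_smooth phi x (fun z => \sum_i f i z).
Proof.
move=> hx cf; have -> : (fun z => \sum_i f i z) = \sum_i f i.
  by apply/funext => z; rewrite fct_sumE.
elim/big_ind : _ => [|f' g'|//]; last exact: chart_smoothD.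
exact: chart_smooth_cst.
Qed.

Lemma chart_smooth_row k l phi x (f : X -> 'rV[R]_k) (g : X -> 'rV[R]_l) :
  cdom phi x -> chart_smooth phi x f -> chart_smooth phi x g ->
  chart_smooth phi x (fun z => row_mx (f z) (g z)).
Proof.
move=> hx cf cg.
have -> : (fun z => row_mx (f z) (g z)) =
    fun z => row_mx (f z) 0 + row_mx 0 (g z).
  by apply/funext => z; rewrite add_row_mx addr0 add0r.
apply: chart_smoothD.
  apply: (chart_smooth_linear (L := fun u => row_mx u 0)) => // a u v.
  by rewrite scale_row_mx add_row_mx scaler0 addr0.
apply: (chart_smooth_linear (L := fun u => row_mx 0 u)) => // a u v.
by rewrite scale_row_mx add_row_mx scaler0 addr0.
Qed.

Lemma chart_smoothV l phi x (f : X -> 'rV[R]_l) (j : 'I_l) :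
  cdom phi x -> f x 0 j != 0 -> chart_smooth phi x f ->
  chart_smooth phi x (fun z => const_mx (f z 0 j)^-1 : 'rV[R]_1).
Proof.
move=> hx f0; pose V := [set y : 'rV[R]_l | y 0 j != 0].
apply: (chart_smooth_post (V := V)
  (G := fun y => const_mx (y 0 j)^-1 : 'rV[R]_1)) => //.
  rewrite (_ : V = (fun y : 'rV[R]_l => y 0 j) @^-1` [set a | a != 0])//.
  apply: open_comp => [y _|]; first exact: coord_continuous.
  exact: open_neq.
move=> r; apply: (of_class_CV (F := id)) => //.
  rewrite (_ : V = (fun y : 'rV[R]_l => y 0 j) @^-1` [set a | a != 0])//.
  apply: open_comp => [y _|]; first exact: coord_continuous.
  exact: open_neq.
exact: (of_class_C_linear r V (@idfun 'rV[R]_l)).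
Qed.

Lemma chart_smooth_cmap phi x :
  chart_near phi x setT -> chart_smooth phi x (cmap phi).
Proof. by move=> /local_rep_id/local_rep_chart_smooth; exists id. Qed.

Lemma local_rep_diff Y k (f : X -> Y) x phi (psi : chart R Y k) F :
  local_rep f x phi psi F -> differentiable F (cmap phi x).
Proof. by move=> [W [oW Wx Wi sF WF]]; exact: (sF 1%N).1. Qed.

(** Representatives agree on a neighbourhood of phi(x), because the image of
    phi contains one; hence the coordinate differential is well defined. *)
Lemma local_rep_diff_unique Y k (f : X -> Y) x phi (psi : chart R Y k) F G :
  local_rep f x phi psi F -> local_rep f x phi psi G ->
  'd G (cmap phi x) = 'd F (cmap phi x) :> (_ -> _).
Proof.
move=> hF [V [oV Vx Vi sG VG]]; have dF := local_rep_diff hF.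
case: hF => W [oW Wx Wi sF WF].
apply/funext; apply: (is_diffE (is_diff_near dF _)).
apply: filterS (open_nbhs_nbhs (conj (openI oW oV) (conj Wx Vx))) => y [Wy Vy].
have [z hz zy] := Wi y Wy; rewrite -zy in Wy Vy *.
by have [_ <-] := WF z hz Wy; have [_ <-] := VG z hz Vy.
Qed.

End Generic.
End LocalReps.

(** * Smooth maps between spaces with an atlas *)

Section Atlases.
Context {R : realType}.
Implicit Types X Y Z : charted R.

(** The charts of a manifold, their injectivity and the smoothness of their
    transitions: what the calculus of smooth maps and tangent vectors rests on.
    Products, total spaces and submanifolds inherit it. *)
Definition has_atlas X : Prop :=
  [/\ forall x : X, exists phi, chart_at x phi,
      forall phi : chart R X (mdim X), atlas phi -> chart_inj phi &
      forall phi psi : chart R X (mdim X),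
        atlas phi -> atlas psi -> smooth_transition phi psi].

Lemma manifold_atlas X : is_manifold X -> has_atlas X.
Proof. by case. Qed.

Lemma atlas_cover X : has_atlas X -> forall x : X, exists phi, chart_at x phi.
Proof. by case. Qed.

Lemma atlas_near X (x : X) phi :
  has_atlas X -> chart_at x phi -> chart_near phi x setT.
Proof.
move=> [_ _ tr] [aphi hx]; have [F hF] := tr _ _ aphi aphi x hx hx.
exact: chart_nearS (local_rep_near hF).
Qed.

Lemma local_rep_change X Y n k (f : X -> Y) x (phi' : chart R X n)
    (psi' : chart R Y k) (phi : chart R X (mdim X)) (psi : chart R Y (mdim Y))
    F P Q : cdom phi x -> cdom phi' x ->
  local_rep id x phi phi' P -> local_rep f x phi' psi' F ->
  local_rep id (f x) psi' psi Q ->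
  local_rep f x phi psi (Q \o F \o P).
Proof.
move=> hx hx' hP hF hQ.
have h : local_rep f x phi psi' (F \o P) := local_rep_comp hx hP hF.
exact: (local_rep_comp hx h hQ).
Qed.

(** Smoothness gives some pair of charts and a representative; the transition
    maps carry these to any pair of charts. *)
Lemma smooth_at_local_rep X Y (f : X -> Y) x phi psi :
  has_atlas X -> has_atlas Y -> smooth_at f x ->
  chart_at x phi -> chart_at (f x) psi ->
  exists F, local_rep f x phi psi F.
Proof.
move=> [_ _ trX] [_ _ trY] [phi' [psi' [F [[a' h'] [b' k'] hF]]]] [a h] [b k].
have [P hP] := trX _ _ a a' x h h'.
have [Q hQ] := trY _ _ b' b (f x) k' k.
by exists (Q \o F \o P); exact: local_rep_change hP hF hQ.
Qed.

Lemma chart_smooth_change X k (f : X -> 'rV[R]_k) x phi psi :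
  has_atlas X -> chart_at x phi -> chart_at x psi ->
  chart_smooth phi x f -> chart_smooth psi x f.
Proof.
move=> [_ _ tr] [a h] [b j] cf; have [F hF] := tr _ _ b a x j h.
exact: (chart_smooth_comp (f := id) j hF).
Qed.

Lemma smooth_at_comp X Y Z (f : X -> Y) (g : Y -> Z) x : has_atlas Y ->
  smooth_at f x -> smooth_at g (f x) -> smooth_at (g \o f) x.
Proof.
move=> [_ _ tr] [phi [psi [F [[a h] [b k] hF]]]] [psi' [chi [G [[b' k'] c hG]]]].
have [T hT] := tr _ _ b b' (f x) k k'.
exists phi, chi, (G \o T \o F); split=> //.
exact: (local_rep_comp h hF (local_rep_comp k hT hG)).
Qed.

Lemma smooth_comp X Y Z (f : X -> Y) (g : Y -> Z) : has_atlas Y ->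
  smooth f -> smooth g -> smooth (g \o f).
Proof. by move=> aY sf sg x; exact: smooth_at_comp. Qed.

Lemma smooth_id X : has_atlas X -> smooth (@id X).
Proof.
move=> aX x; have [phi hphi] := atlas_cover aX x; exists phi, phi, id; split => //.
exact: local_rep_id (atlas_near aX hphi).
Qed.

Lemma smooth_at_euclidean X k (f : X -> euclidean k) x phi :
  has_atlas X -> chart_at x phi ->
  smooth_at f x <-> chart_smooth phi x (f : X -> 'rV[R]_k).
Proof.
move=> aX hphi; split=> [[phi' [psi [F [hphi' [ae he] hF]]]]|[F hF]].
  apply: (chart_smooth_change aX hphi' hphi).
  by exists F; move: hF; rewrite (ae : psi = id_chart k).
by exists phi, (id_chart k), F.
Qed.

End Atlases.

(** * Products *)

Section Products.
Context {R : realType}.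
Implicit Types X Y Z : charted R.

Lemma open_linear_preimage k l (L : 'rV[R]_k -> 'rV[R]_l) (W : set 'rV[R]_l) :
  linear L -> open W -> open (L @^-1` W).
Proof.
move=> /linear_bundle[g <-] oW; apply: open_comp => // x _.
exact: linear_rV_continuous.
Qed.

Definition prod_chart (X Y : Type) n k (phi : chart R X n) (psi : chart R Y k) :
    chart R (X * Y)%type (n + k) :=
  Chart [set p : X * Y | cdom phi p.1 /\ cdom psi p.2]
        (fun p => row_mx (cmap phi p.1) (cmap psi p.2)).

Lemma chart_near_prod (X Y : Type) n k (phi : chart R X n) (psi : chart R Y k)
    p P Q : chart_near phi p.1 P -> chart_near psi p.2 Q ->
  chart_near (prod_chart phi psi) p [set q | P q.1 /\ Q q.2].
Proof.
move=> [W [oW Wx Wi WP]] [V [oV Vy Vi VQ]].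
exists (lsubmx @^-1` W `&` rsubmx @^-1` V); split.
- by apply: openI; apply: open_linear_preimage => //; exact: linearP.
- by split; rewrite /= ?row_mxKl ?row_mxKr.
- move=> c [/Wi[x hx xc] /Vi[y hy yc]]; exists (x, y) => //=.
  by rewrite xc yc hsubmxK.
- move=> q [hq1 hq2] /= [Wq Vq]; rewrite row_mxKl in Wq; rewrite row_mxKr in Vq.
  by split; [exact: WP|exact: VQ].
Qed.

Lemma local_rep_fst (X Y : Type) n k (phi : chart R X n) (psi : chart R Y k) p :
  chart_near phi p.1 setT -> chart_near psi p.2 setT ->
  local_rep fst p (prod_chart phi psi) phi lsubmx.
Proof.
move=> nx ny; have [W [oW Wp Wi _]] := chart_near_prod nx ny.
exists W; split=> // [r|q [hq _] _]; first exact: of_class_C_linear.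
by rewrite /= row_mxKl.
Qed.

Lemma local_rep_snd (X Y : Type) n k (phi : chart R X n) (psi : chart R Y k) p :
  chart_near phi p.1 setT -> chart_near psi p.2 setT ->
  local_rep snd p (prod_chart phi psi) psi rsubmx.
Proof.
move=> nx ny; have [W [oW Wp Wi _]] := chart_near_prod nx ny.
exists W; split=> // [r|q [_ hq] _]; first exact: of_class_C_linear.
by rewrite /= row_mxKr.
Qed.

Lemma local_rep_pair (X Y Z : Type) n k l (phi : chart R X n)
    (psi : chart R Y k) (chi : chart R Z l) (f : Z -> X) (g : Z -> Y) z F G :
  cdom chi z -> local_rep f z chi phi F -> local_rep g z chi psi G ->
  exists H, local_rep (fun z => (f z, g z)) z chi (prod_chart phi psi) H.
Proof.
move=> hz hF hG; apply: local_rep_intro.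
  exact: chart_nearI (local_rep_near hF) (local_rep_near hG).
by apply: chart_smooth_row => //; [exists F|exists G];
  exact: local_rep_chart_smooth.
Qed.

Lemma atlas_prod X Y (phi : chart R X (mdim X)) (psi : chart R Y (mdim Y)) :
  atlas phi -> atlas psi -> atlas (c := mprod X Y) (prod_chart phi psi).
Proof. by move=> a b; exists phi, psi. Qed.

Lemma mprod_atlas X Y : has_atlas X -> has_atlas Y -> has_atlas (mprod X Y).
Proof.
move=> aX aY; have [covX injX trX] := aX; have [covY injY trY] := aY; split.
- move=> [x y]; have [phi [a h]] := covX x; have [psi [b k]] := covY y.
  by exists (prod_chart phi psi); split=> //; exact: atlas_prod.
- move=> _ [phi [psi [a b ->]]] [x y] [x' y'] /= [hx hy] [hx' hy'].
  by move/eq_row_mx => [/(injX _ a _ _ hx hx') -> /(injY _ b _ _ hy hy') ->].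
- move=> _ _ [phi [psi [a b ->]]] [phi' [psi' [a' b' ->]]] [x y] [hx hy] [hx' hy'].
  have nx : chart_near phi x setT by exact: atlas_near.
  have ny : chart_near psi y setT by exact: atlas_near.
  have [F hF] := trX _ _ a a' x hx hx'; have [G hG] := trY _ _ b b' y hy hy'.
  have h : cdom (prod_chart phi psi) (x, y) by [].
  have [H hH] := local_rep_pair (f := fst) (g := snd) h
    (local_rep_comp h (local_rep_fst (p := (x, y)) nx ny) hF)
    (local_rep_comp h (local_rep_snd (p := (x, y)) nx ny) hG).
  exists H; apply: local_rep_eq hH.
  have [W [oW Wp Wi _]] := chart_near_prod (p := (x, y)) nx ny.
  by exists W; split=> // -[].
Qed.

Lemma smooth_fst X Y : has_atlas X -> has_atlas Y ->
  smooth (fst : mprod X Y -> X).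
Proof.
move=> aX aY p; have [phi hphi] := atlas_cover aX p.1.
have [psi hpsi] := atlas_cover aY p.2.
exists (prod_chart phi psi), phi, lsubmx; split => //.
- by split; [exact: atlas_prod hphi.1 hpsi.1|split; [exact: hphi.2|exact: hpsi.2]].
- by apply: local_rep_fst; exact: atlas_near.
Qed.

Lemma smooth_snd X Y : has_atlas X -> has_atlas Y ->
  smooth (snd : mprod X Y -> Y).
Proof.
move=> aX aY p; have [phi hphi] := atlas_cover aX p.1.
have [psi hpsi] := atlas_cover aY p.2.
exists (prod_chart phi psi), psi, rsubmx; split => //.
- by split; [exact: atlas_prod hphi.1 hpsi.1|split; [exact: hphi.2|exact: hpsi.2]].
- by apply: local_rep_snd; exact: atlas_near.
Qed.

Lemma smooth_pair X Y Z (f : Z -> X) (g : Z -> Y) :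
  has_atlas X -> has_atlas Y -> has_atlas Z ->
  smooth f -> smooth g -> smooth (fun z => (f z, g z) : mprod X Y).
Proof.
move=> aX aY aZ sf sg z; have [chi hchi] := atlas_cover aZ z.
have [phi hphi] := atlas_cover aX (f z); have [psi hpsi] := atlas_cover aY (g z).
have [F hF] := smooth_at_local_rep aZ aX (sf z) hchi hphi.
have [G hG] := smooth_at_local_rep aZ aY (sg z) hchi hpsi.
have [H hH] := local_rep_pair hchi.2 hF hG.
exists chi, (prod_chart phi psi), H; split=> //.
by split; [exact: atlas_prod hphi.1 hpsi.1|split; [exact: hphi.2|exact: hpsi.2]].
Qed.

End Products.

(** * Total spaces of vector bundles *)

Section TotalSpaces.
Context {R : realType}.
Implicit Types X Y Z : charted R.

Definition total_chart X (E : vbundle X) (phi : chart R X (mdim X))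
    (tau : set X * (forall x, E x -> 'rV[R]_(vrank E))) :
    chart R (total_space E) (mdim X + vrank E) :=
  Chart [set e : {x : X & E x} | cdom phi (tag e) /\ tau.1 (tag e)]
        (fun e => row_mx (cmap phi (tag e)) (tau.2 (tag e) (tagged e))).

Definition fibre_coord X (E : vbundle X)
    (tau : set X * (forall x, E x -> 'rV[R]_(vrank E))) (e : total_space E) :
  'rV[R]_(vrank E) := tau.2 (tag e) (tagged e).

Lemma mopen_near X (x : X) phi (U : set X) :
  has_atlas X -> chart_at x phi -> mopen U -> U x -> chart_near phi x U.
Proof.
move=> [_ inj _] [a h] oU Ux; exists (cmap phi @` (U `&` cdom phi)); split.
- exact: oU.
- by exists x.
- by move=> _ [z [_ hz] <-]; exists z.
- move=> z hz [z' [Uz' hz'] zz'].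
  by rewrite -(inj _ a _ _ hz' hz zz').
Qed.

Section OneBundle.
Context {X : charted R} (E : vbundle X).
Hypotheses (aX : has_atlas X) (bE : is_vbundle E).

Lemma triv_near (x : X) phi tau : chart_at x phi -> trivs (v := E) tau ->
  tau.1 x -> chart_near phi x tau.1.
Proof. by case: bE => tr _ _ hphi /tr[oU _] Ux; exact: mopen_near. Qed.

(** The fibre coordinates are onto over every point of the domain of the
    trivialization, so that the coordinate image is a cylinder. *)
Lemma total_chart_near (e : total_space E) phi tau P :
  chart_at (tag e) phi -> trivs (v := E) tau -> tau.1 (tag e) ->
  chart_near phi (tag e) P ->
  chart_near (total_chart phi tau) e [set e | P (tag e)].
Proof.
move=> hphi htau Ue nP.
have [W [oW We Wi WP]] := chart_nearI (triv_near hphi htau Ue) nP.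
exists (lsubmx @^-1` W); split.
- by apply: open_linear_preimage => //; exact: linearP.
- by rewrite /= row_mxKl.
- move=> c Wc; have [x hx xc] := Wi _ Wc.
  have Ux : tau.1 x by apply: (WP x hx _).1; rewrite xc.
  have [tr _ _] := bE; have [_ /(_ x Ux)[_ [s _ sK]]] := tr _ htau.
  exists (point_in (s (rsubmx c))) => //=.
  by rewrite xc sK hsubmxK.
- by move=> z [hz _]; rewrite /= row_mxKl => /(WP _ hz)[].
Qed.

Lemma local_rep_tag (e : total_space E) phi tau :
  chart_at (tag e) phi -> trivs (v := E) tau -> tau.1 (tag e) ->
  local_rep (@tag _ _) e (total_chart phi tau) phi lsubmx.
Proof.
move=> hphi htau Ue.
have [W [oW We Wi _]] :=
  total_chart_near hphi htau Ue (atlas_near aX hphi).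
exists W; split=> // [r|z [hz _] _]; first exact: of_class_C_linear.
by rewrite /= row_mxKl.
Qed.

Lemma fibre_coord_smooth (e : total_space E) phi tau :
  chart_at (tag e) phi -> trivs (v := E) tau -> tau.1 (tag e) ->
  chart_smooth (total_chart phi tau) e (fibre_coord tau).
Proof.
move=> hphi htau Ue.
have nT := total_chart_near hphi htau Ue (atlas_near aX hphi).
have -> : fibre_coord tau = rsubmx \o cmap (total_chart phi tau).
  by apply/funext => z; rewrite /= row_mxKr.
apply: chart_smooth_linear; [exact: linearP|by split; [exact: hphi.2|]|].
exact: chart_smooth_cmap.
Qed.

Lemma local_rep_total (Z : Type) n (chi : chart R Z n) (h : Z -> total_space E)
    z phi tau F : cdom chi z ->
  chart_at (tag (h z)) phi -> trivs (v := E) tau -> tau.1 (tag (h z)) ->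
  local_rep (@tag _ _ \o h) z chi phi F ->
  chart_smooth chi z (fibre_coord tau \o h) ->
  exists H, local_rep h z chi (total_chart phi tau) H.
Proof.
move=> hz hphi htau Uz hF sh; apply: local_rep_intro.
  apply: chart_nearI (local_rep_near hF) _.
  exact: (chart_near_comp hz hF (triv_near hphi htau Uz)).
by apply: chart_smooth_row => //; exists F; exact: local_rep_chart_smooth hF.
Qed.

(** The change of trivialization acts by e g = sum_i e_i (row i of g), a sum
    of products of smooth scalar and vector functions. *)
Lemma fibre_coord_change (e : total_space E) tau tau' phi :
  chart_at (tag e) phi ->
  trivs (v := E) tau -> trivs (v := E) tau' -> tau.1 (tag e) -> tau'.1 (tag e) ->
  chart_smooth (total_chart phi tau) e (fibre_coord tau').
Proof.
move=> hphi htau htau' Ue Ue'; have [_ _ tr] := bE.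
have [g [sg Eg]] := tr _ _ htau htau'.
have h : cdom (total_chart phi tau) e by split; [exact: hphi.2|].
have nU := total_chart_near hphi htau Ue
  (chart_nearI (triv_near hphi htau Ue) (triv_near hphi htau' Ue')).
apply: (chart_smooth_eq (f := fun z : total_space E =>
    \sum_i fibre_coord tau z 0 i *: row i (g (tag z)))).
  apply: chart_nearS nU => z [Uz Uz'].
  by rewrite /fibre_coord (Eg _ _ Uz Uz') mulmx_sum_row.
apply: chart_smooth_sum => [|i]; first exact: chart_nearS nU.
apply: chart_smoothZ; first exact: fibre_coord_smooth.
have sg' := (smooth_at_euclidean _ aX hphi).1 (sg _ Ue Ue').
have -> : (fun z : total_space E => row i (g (tag z))) =
    (row i \o vec_mx) \o (fun z : total_space E => mxvec (g (tag z))).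
  by apply/funext => z; rewrite /= mxvecK.
apply: chart_smooth_linear => //; first exact: linearP.
exact: (chart_smooth_comp h (local_rep_tag hphi htau Ue) sg').
Qed.

Lemma total_atlas : has_atlas (total_space E).
Proof.
have [cov inj trX] := aX; have [trE covE _] := bE; split.
- move=> e; have [phi hphi] := cov (tag e); have [tau htau Ue] := covE (tag e).
  by exists (total_chart phi tau); split;
    [exists phi, tau; split=> //; exact: hphi.1|split; [exact: hphi.2|]].
- move=> _ [phi [tau [a htau ->]]] [x e] [x' e'] /= [hx Ux] [hx' Ux'].
  move/eq_row_mx => [/(inj _ a _ _ hx hx') xx'].
  case: _ / xx' e' {hx' Ux'} => e' /= ee'.
  have [_ /(_ x Ux)[_ /bij_inj injt]] := trE _ htau.
  by rewrite (injt _ _ ee').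
- move=> _ _ [phi [tau [a htau ->]]] [phi' [tau' [a' htau' ->]]].
  move=> e [hx Ux] [hx' Ux'].
  have hphi : chart_at (tag e) phi by [].
  have hphi' : chart_at (tag e) phi' by [].
  have [F hF] := trX _ _ a a' _ hx hx'.
  have h : cdom (total_chart phi tau) e by [].
  apply: (local_rep_total h hphi' htau' Ux' (F := F \o lsubmx)).
    exact: (local_rep_comp h (local_rep_tag hphi htau Ux) hF).
  exact: fibre_coord_change.
Qed.

Lemma smooth_tag : smooth (@tag _ _ : total_space E -> X).
Proof.
move=> e; have [phi hphi] := atlas_cover aX (tag e).
have [_ covE _] := bE; have [tau htau Ue] := covE (tag e).
exists (total_chart phi tau), phi, lsubmx; split=> //.
- by split; [exists phi, tau; split=> //; exact: hphi.1|split; [exact: hphi.2|]].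
- exact: local_rep_tag.
Qed.

(** One trivialization suffices to test smoothness into a total space: the
    other charts there are reached by smooth transitions. Every bundle map below
    is shown to be smooth through this criterion. *)
Lemma smooth_at_total Z (h : Z -> total_space E) z phi tau : has_atlas Z ->
  chart_at z phi -> trivs (v := E) tau -> tau.1 (tag (h z)) ->
  smooth_at h z <-> smooth_at (@tag _ _ \o h : Z -> X) z /\
                    chart_smooth phi z (fibre_coord tau \o h).
Proof.
move=> aZ hphi htau Uz; split=> [sh|[sth [G hG]]].
  split; first exact: smooth_at_comp total_atlas sh (smooth_tag (h z)).
  have [psi hpsi] := atlas_cover aX (tag (h z)).
  have hchi : chart_at (h z) (total_chart psi tau).
    by split; [exists psi, tau; split=> //; exact: hpsi.1|split; [exact: hpsi.2|]].
  have [F hF] := smooth_at_local_rep aZ total_atlas sh hphi hchi.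
  apply: (chart_smooth_comp hphi.2 hF).
  exact: fibre_coord_smooth.
have [psi hpsi] := atlas_cover aX (tag (h z)).
have [F hF] := smooth_at_local_rep aZ aX sth hphi hpsi.
have [H hH] := local_rep_total hphi.2 hpsi htau Uz hF (ex_intro _ G hG).
exists phi, (total_chart psi tau), H; split=> //.
by split; [exists psi, tau; split=> //; exact: hpsi.1|split; [exact: hpsi.2|]].
Qed.

End OneBundle.
End TotalSpaces.

(** * Submanifolds *)

Section Submanifolds.
Context {R : realType}.

(** Right multiplication by pid_mx k pads a row of length k with zeros, or
    truncates a longer row to length k. These are the coordinate expressions of
    the inclusion of a slice and of the projection onto it. *)
Lemma pid_mx_entry k n (c : 'rV[R]_k) (j : 'I_n) :
  (c *m (pid_mx k : 'M[R]_(k, n))) 0 j = \sum_(i < k) c 0 i *+ (val i == val j).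
Proof.
rewrite mxE; apply: eq_bigr => i _; rewrite mxE ltn_ord andbT.
by case: eqP; rewrite ?mulr1 ?mulr0.
Qed.

Lemma pad_entry_lt k n (c : 'rV[R]_k) (j : 'I_n) (i : 'I_k) :
  i = j :> nat -> (c *m (pid_mx k : 'M[R]_(k, n))) 0 j = c 0 i.
Proof.
move=> ij; rewrite pid_mx_entry (bigD1 i)//= ij eqxx big1 ?addr0 // => i' ni.
by rewrite -ij (inj_eq val_inj) (negPf ni).
Qed.

Lemma pad_entry_ge k n (c : 'rV[R]_k) (j : 'I_n) :
  (k <= j)%N -> (c *m (pid_mx k : 'M[R]_(k, n))) 0 j = 0.
Proof.
move=> kj; rewrite pid_mx_entry big1// => i _.
by rewrite ltn_eqF// (leq_trans (ltn_ord i)).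
Qed.

Lemma take_entry k n (v : 'rV[R]_n) (i : 'I_k) (j : 'I_n) :
  i = j :> nat -> (v *m (pid_mx k : 'M[R]_(n, k))) 0 i = v 0 j.
Proof.
move=> ij; rewrite mxE (bigD1 j)//= big1 ?addr0.
  by rewrite mxE -ij ltn_ord eqxx mulr1.
by move=> l nl; rewrite mxE ij (inj_eq val_inj) (negPf nl) mulr0.
Qed.

Lemma mulmx_linear m n (A : 'M[R]_(m, n)) : linear (fun c : 'rV[R]_m => c *m A).
Proof. by move=> a u v; rewrite mulmxDl -scalemxAl. Qed.

Lemma smooth_on_linear n k (L : 'rV[R]_n -> 'rV[R]_k) W :
  linear L -> smooth_on W L.
Proof. by move=> /linear_bundle[g <-] r; exact: of_class_C_linear. Qed.

(** By transitivity of smooth changes of coordinates, compatibility with the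
    atlas may be tested on a single chart at each point. *)
Lemma maximal_atlas_intro (X : charted R) (psi : chart R X (mdim X)) :
  has_atlas X -> chart_inj psi ->
  (forall x, cdom psi x -> exists phi, chart_at x phi /\
     (exists F, local_rep id x psi phi F) /\
     (exists F, local_rep id x phi psi F)) ->
  maximal_atlas psi.
Proof.
move=> [_ _ tr] inj H; split=> // phi a; split=> x hx hx'.
  have [phi' [[a' h'] [_ [F hF]]]] := H x hx'.
  have [G hG] := tr _ _ a a' x hx h'.
  by exists (F \o G); exact: (local_rep_comp (f := id) (g := id) hx hG hF).
have [phi' [[a' h'] [[F hF] _]]] := H x hx.
have [G hG] := tr _ _ a' a x h' hx'.
by exists (G \o F); exact: (local_rep_comp (f := id) (g := id) hx hF hG).
Qed.

Section OneSubmfd.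
Context {X : charted R} (S : set X) (k : nat).
Hypothesis aX : has_atlas X.
Implicit Types phi psi : chart R X (mdim X).

Definition slice_chart (psi : chart R X (mdim X)) (chi : chart R (submfd S k) k) :
    Prop :=
  [/\ maximal_atlas psi, (k <= mdim X)%N,
      forall x, cdom psi x ->
        (S x <-> forall i : 'I_(mdim X), (k <= i)%N -> cmap psi x 0 i = 0),
      forall y, cdom chi y <-> cdom psi (sval y) &
      forall y (i : 'I_k) (j : 'I_(mdim X)), cdom chi y ->
        i = j :> nat -> cmap chi y 0 i = cmap psi (sval y) 0 j].

Lemma maximal_near psi x : maximal_atlas psi -> cdom psi x ->
  chart_near psi x setT.
Proof.
move=> [_ tr] hx; have [phi [a h]] := atlas_cover aX x.
have [_ /(_ x hx h) [F hF]] := tr _ a.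
exact: chart_nearS (local_rep_near hF).
Qed.

Section OneChart.
Variables (psi : chart R X (mdim X)) (chi : chart R (submfd S k) k).
Hypothesis sc : slice_chart psi chi.

Lemma slice_cmap y : cdom chi y ->
  cmap chi y = cmap psi (sval y) *m (pid_mx k : 'M[R]_(mdim X, k)).
Proof.
case: sc => _ kn _ _ coord hy; apply/rowP => i.
by rewrite (@take_entry k _ _ i (widen_ord kn i))//; exact: coord.
Qed.

Lemma slice_cmap_pad y : cdom chi y ->
  cmap psi (sval y) = cmap chi y *m (pid_mx k : 'M[R]_(k, mdim X)).
Proof.
case: sc => _ kn slice dom coord hy; apply/rowP => j.
have hx : cdom psi (sval y) by exact/dom.
have [jk|kj] := ltnP j k.
  by rewrite (@pad_entry_lt k _ _ j (Ordinal jk))//; exact/esym/coord.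
by rewrite pad_entry_ge//; apply: ((slice _ hx).1 (svalP y)).
Qed.

(** Every point of the ambient chart whose last coordinates vanish lies in S;
    this is why the restricted chart has open image. *)
Lemma local_rep_sval y : cdom chi y ->
  local_rep sval y chi psi (fun c => c *m (pid_mx k : 'M[R]_(k, mdim X))).
Proof.
move=> hy; case: (sc) => mpsi kn slice dom coord.
have hx : cdom psi (sval y) by exact/dom.
have [W [oW Wx Wi _]] := maximal_near mpsi hx.
exists ((fun c => c *m (pid_mx k : 'M[R]_(k, mdim X))) @^-1` W); split.
- by apply: open_linear_preimage => //; exact: mulmx_linear.
- by rewrite /= -slice_cmap_pad.
- move=> c /Wi[x hpx xc].
  have Sx : S x by apply/slice => // i ki; rewrite xc pad_entry_ge.
  exists (exist S x Sx); first exact/dom.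
  rewrite slice_cmap /=; last exact/dom.
  rewrite xc -mulmxA mul_pid_mx minnn (minn_idPr kn).
  by rewrite pid_mx_1 mulmx1.
- exact/smooth_on_linear/mulmx_linear.
- by move=> z hz _; split; [exact/dom|exact: slice_cmap_pad].
Qed.

Lemma local_rep_into (Z : Type) n (zeta : chart R Z n) (h : Z -> submfd S k) z F :
  local_rep (sval \o h) z zeta psi F ->
  local_rep h z zeta chi (fun v => F v *m (pid_mx k : 'M[R]_(mdim X, k))).
Proof.
case: (sc) => mpsi kn slice dom coord [W [oW Wx Wi sF WF]].
exists W; split=> //.
- move=> r; apply: (of_class_C_comp (V := setT)
    (G := fun v => v *m (pid_mx k : 'M[R]_(mdim X, k))) oW _ (sF r)) => //.
  exact/smooth_on_linear/mulmx_linear.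
- move=> y hy Wy; have [hp Fy] := WF y hy Wy.
  have hc : cdom chi (h y) by exact/dom.
  by rewrite slice_cmap// -Fy.
Qed.

End OneChart.

Hypothesis cov : forall y : submfd S k, exists chi, chart_at y chi.

Lemma maximal_trans psi psi' x : maximal_atlas psi -> maximal_atlas psi' ->
  cdom psi x -> cdom psi' x -> exists F, local_rep id x psi psi' F.
Proof.
move=> [_ tr] [_ tr'] h h'; have [phi [a hphi]] := atlas_cover aX x.
have [_ /(_ x h hphi) [F hF]] := tr _ a.
have [/(_ x hphi h') [G hG] _] := tr' _ a.
by exists (G \o F); exact: (local_rep_comp (f := id) (g := id) h hF hG).
Qed.

Lemma atlas_maximal phi : atlas phi -> maximal_atlas (X := X) phi.
Proof.
case: aX => _ inj tr a; split=> [|phi' a']; first exact: inj.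
by split; exact: tr.
Qed.

Lemma submfd_atlas : has_atlas (submfd S k).
Proof.
split=> //.
- move=> chi [psi sc] y y' hy hy' E.
  have sy := slice_cmap_pad sc hy; rewrite E -(slice_cmap_pad sc hy') in sy.
  case: (sc) => -[inj _] _ _ dom _.
  have {}sy := inj _ _ ((dom y).1 hy) ((dom y').1 hy') sy.
  case: y y' sy {hy hy' E} => x Sx [x' Sx'] /= xx'.
  by case: _ / xx' Sx' => Sx'; congr exist; exact: Prop_irrelevance.
- move=> chi chi' [psi sc] [psi' sc'] y hy hy'.
  have [m _ _ dom _] := sc; have [m' _ _ dom' _] := sc'.
  have [T hT] := maximal_trans m m' ((dom y).1 hy) ((dom' y).1 hy').
  eexists; apply: (local_rep_into (h := id) sc').
  exact: (local_rep_comp (g := id) hy (local_rep_sval sc hy) hT).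
Qed.

Lemma smooth_sval : smooth (sval : submfd S k -> X).
Proof.
move=> y; have [chi [[psi sc] hy]] := cov y.
have [phi [a h]] := atlas_cover aX (sval y).
have [m _ _ dom _] := sc.
have [T hT] := maximal_trans m (atlas_maximal a) ((dom y).1 hy) h.
exists chi, phi; eexists; split=> //; first by split=> //; exists psi.
exact: (local_rep_comp (g := id) hy (local_rep_sval sc hy) hT).
Qed.

Lemma smooth_into (Z : charted R) (h : Z -> submfd S k) : has_atlas Z ->
  smooth (sval \o h : Z -> X) -> smooth h.
Proof.
move=> aZ sh z; have [chi [[psi sc] hy]] := cov (h z).
have [phi [a hphi]] := atlas_cover aX (sval (h z)).
have [zeta hzeta] := atlas_cover aZ z.
have [F hF] := smooth_at_local_rep (phi := zeta) (psi := phi) aZ aX (sh z) hzeta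
  (conj a hphi).
have [m _ _ dom _] := sc.
have [T hT] := maximal_trans (atlas_maximal a) m hphi ((dom _).1 hy).
exists zeta, chi; eexists; split=> //; first by split=> //; exists psi.
apply: (local_rep_into sc).
exact: (local_rep_comp (g := id) hzeta.2 hF hT).
Qed.

End OneSubmfd.
End Submanifolds.

(** * Fibre products that are graphs *)

Section FibreProducts.
Context {R : realType}.
Implicit Types X Y Z : charted R.

Lemma smooth_fpr X Y Z (f : X -> Z) (g : Y -> Z) : has_atlas X -> has_atlas Y ->
  (forall p : fibre_prod f g, exists chi, chart_at p chi) ->
  smooth (@fpr1 _ _ _ _ f g) /\ smooth (@fpr2 _ _ _ _ f g).
Proof.
move=> aX aY cov; have aXY := mprod_atlas aX aY.
have ss : smooth (sval : fibre_prod f g -> mprod X Y) := smooth_sval aXY cov.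
split; first exact: (smooth_comp aXY ss (smooth_fst aX aY)).
exact: (smooth_comp aXY ss (smooth_snd aX aY)).
Qed.

Section Graph.
Variables (X Y Z : charted R) (f : X -> Z) (g : Y -> Z) (h : Z -> Y).
Hypotheses (aX : has_atlas X) (aY : has_atlas Y) (aZ : has_atlas Z).
Hypotheses (gK : cancel g h) (hK : cancel h g) (dimYZ : mdim Y = mdim Z).
Hypotheses (sf : smooth f) (sh : smooth h).

(** Since g is invertible, f x = g y describes the graph of h o f, which the
    coordinates (phi(x), psi(y) - psi(h(f x))) flatten. *)
Lemma graph_slice (x0 : X) (y0 : Y) : h (f x0) = y0 ->
  exists psi : chart R (mprod X Y) (mdim (mprod X Y)),
    [/\ maximal_atlas psi, cdom psi (x0, y0) &
        forall p, cdom psi p -> (f p.1 = g p.2 <->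
          forall i : 'I_(mdim (mprod X Y)), (mdim X <= i)%N -> cmap psi p 0 i = 0)].
Proof.
move=> xy0; have [phi hphi] := atlas_cover aX x0.
have [psi hpsi] := atlas_cover aY y0.
have aXY := mprod_atlas aX aY.
have [_ injX _] := aX; have [_ injY _] := aY.
have shf := smooth_at_comp aZ (sf x0) (sh (f x0)).
rewrite -xy0 in hpsi.
have [u [W [oW Wx Wi su Wu]]] := smooth_at_local_rep aX aY shf hphi hpsi.
rewrite xy0 in hpsi.
pose D := [set p : X * Y | [/\ cdom phi p.1, W (cmap phi p.1) & cdom psi p.2]].
pose Psi : chart R (mprod X Y) (mdim (mprod X Y)) := Chart D
  (fun p => row_mx (cmap phi p.1) (cmap psi p.2 - u (cmap phi p.1))).
have nX x : cdom phi x -> chart_near phi x setT.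
  by move=> hx; apply: (atlas_near aX); split=> //; exact: hphi.1.
have nY y : cdom psi y -> chart_near psi y setT.
  by move=> hy; apply: (atlas_near aY); split=> //; exact: hpsi.1.
(* The change of coordinates from the slice chart to the product chart, and
   its inverse, are c + U c and c - U c. *)
pose U (c : 'rV[R]_(mdim X + mdim Y)) : 'rV[R]_(mdim X + mdim Y) :=
  row_mx 0 (u (lsubmx c)).
have oW1 : open (lsubmx @^-1` W : set 'rV[R]_(mdim X + mdim Y)).
  by apply: open_linear_preimage => //; exact: linearP.
have sU r : of_class_C r (lsubmx @^-1` W) U.
  apply: (of_class_C_comp (V := W) (F := lsubmx)
    (G := fun a => row_mx 0 (u a) : 'rV[R]_(mdim X + mdim Y)) oW1) => //.
    exact: of_class_C_linear.
  apply: (of_class_C_comp (V := setT) (F := u)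
    (G := fun b => row_mx 0 b : 'rV[R]_(mdim X + mdim Y)) oW) => //.
  apply: smooth_on_linear => a b c.
  by rewrite scale_row_mx add_row_mx scaler0 addr0.
have sid r V : of_class_C r V (fun c : 'rV[R]_(mdim X + mdim Y) => c).
  exact: (smooth_on_linear (L := id)).
exists Psi; split; last first.
- move=> [x y] [/= hx Wfx hy].
  have [hhx Ex] : cdom psi (h (f x)) /\ cmap psi (h (f x)) = u (cmap phi x).
    exact: Wu.
  split=> [fg i|z0].
    have -> : cmap psi y - u (cmap phi x) = 0 by rewrite -Ex fg gK subrr.
    by move=> ki; rewrite mxE; case: splitP => [j ij|j _];
      [move: (ltn_ord j); rewrite -ij ltnNge ki|rewrite mxE].
  rewrite -(hK (f x)); congr g; apply: (injY _ hpsi.1) => //.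
  rewrite Ex; apply/esym/eqP; rewrite -subr_eq0; apply/eqP/rowP => j.
  have := z0 (rshift _ j); rewrite leq_addr => /(_ isT).
  by rewrite row_mxEr => ->; rewrite mxE.
- by split; [exact: hphi.2|exact: Wx|exact: hpsi.2].
apply: maximal_atlas_intro => //.
  move=> [x y] [x' y'] [/= hx Wfx hy] [/= hx' Wfx' hy'].
  move/eq_row_mx => [/(injX _ hphi.1 _ _ hx hx') -> /addIr].
  by move=> /(injY _ hpsi.1 _ _ hy hy') ->.
move=> [x y] [/= hx Wfx hy]; exists (prod_chart phi psi); split.
  by split; [exact: atlas_prod hphi.1 hpsi.1|].
have [V [oV Vy Vi _]] := nY y hy.
split.
- exists (fun c => c + U c).
  exists ((lsubmx @^-1` W) `&` (fun c => rsubmx (c + U c)) @^-1` V); split.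
  + apply: (open_preimage_within oW1 oV).
    apply: (of_class_C_comp (V := setT) (F := fun c => c + U c) (G := rsubmx) oW1).
    * by [].
    * exact: (of_class_CD oW1 (sid 0%N _) (sU 0%N)).
    * exact: of_class_C_linear.
  + split; rewrite /= ?row_mxKl // /U row_mxKl linearD /= !row_mxKr subrK.
    exact: Vy.
  + move=> c [/= Wc Vc]; have [x' hx' xc] := Wi _ Wc.
    have [y' hy' yc] := Vi _ Vc.
    exists (x', y'); first by split=> //=; rewrite xc.
    rewrite /= xc yc -[RHS]hsubmxK; congr row_mx.
    by rewrite linearD /= row_mxKr addrK.
  + move=> r; apply: (@of_class_C_subset _ _ _ _ (lsubmx @^-1` W)) => [c []//|].
    by apply: of_class_CD oW1 _ _; [exact: sid|exact: sU].
  + move=> [x' y'] [/= hx' Wx' hy'] _; split=> //=.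
    by rewrite /U row_mxKl add_row_mx addr0 subrK.
- have [V2 [oV2 Vp Vi2 _]] := chart_near_prod (p := (x, y)) (nX x hx) (nY y hy).
  exists (fun c => c - U c), (V2 `&` lsubmx @^-1` W); split.
  + exact: openI.
  + by split=> //=; rewrite row_mxKl.
  + by move=> c [/Vi2].
  + move=> r; apply: (@of_class_C_subset _ _ _ _ (lsubmx @^-1` W)) => [c []//|].
    apply: (of_class_CD oW1); first exact: sid.
    apply: (of_class_C_comp (V := setT) (F := U) (G := fun b => - b) oW1) => //.
    by apply: smooth_on_linear => a b c; rewrite opprD scalerN.
  + move=> [x' y'] [/= hx' hy'] [/= _ Wx']; rewrite row_mxKl in Wx'.
    by split=> //=; rewrite /U row_mxKl opp_row_mx add_row_mx oppr0 addr0.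
Qed.

(** The dimension dim X + dim Y - dim Z required of the slice is that of X,
    the base of the graph. *)
Lemma graph_fibre_prod_cover (p : fibre_prod f g) : exists chi, chart_at p chi.
Proof.
case: p => [[x y] fg].
have [|psi [mpsi hp slice]] := @graph_slice x y; first by rewrite fg /= gK.
have kX : (mdim X + mdim Y - mdim Z = mdim X)%N by rewrite dimYZ addnK.
have kn : (mdim X + mdim Y - mdim Z <= mdim (mprod X Y))%N.
  by rewrite kX leq_addr.
pose chi : chart R (fibre_prod f g) (mdim (fibre_prod f g)) :=
  Chart [set q | cdom psi (sval q)]
    (fun q => cmap psi (sval q) *m (pid_mx (mdim X + mdim Y - mdim Z))).
exists chi; split=> //; exists psi; split=> //.
- by move=> q /slice sq; rewrite kX.
- by move=> q i j _ ij; rewrite /= (take_entry _ ij).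
Qed.

(** The inverse of the projection of the graph to its base. *)
Definition graph_section (x : X) : fibre_prod f g :=
  exist (fun p : mprod X Y => f p.1 = g p.2) (x, h (f x)) (esym (hK (f x))).

Lemma graph_sectionK p : graph_section (fpr1 p) = p.
Proof.
case: p => [[x y] fg]; apply: eq_exist => /=.
by rewrite /fpr1 /= fg gK.
Qed.

Lemma smooth_graph_section : smooth graph_section.
Proof.
apply: (smooth_into (mprod_atlas aX aY) graph_fibre_prod_cover aX).
apply: smooth_pair => //; first exact: smooth_id.
exact: smooth_comp aZ sf sh.
Qed.

End Graph.
End FibreProducts.

(** * Tangent vectors and tangent maps *)

Section TangentVectors.
Context {R : realType}.
Implicit Types X Y Z : charted R.

Lemma local_rep_at (X Y : Type) n k (f : X -> Y) x (phi : chart R X n)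
    (psi : chart R Y k) F : cdom phi x -> local_rep f x phi psi F ->
  cdom psi (f x) /\ cmap psi (f x) = F (cmap phi x).
Proof. by move=> hx [W [_ Wx _ _ WF]]; exact: WF. Qed.

Lemma local_rep_diff_comp (X Y Z : Type) n k l (f : X -> Y) (g : Y -> Z) x
    (phi : chart R X n) (psi : chart R Y k) (chi : chart R Z l) F G H :
  cdom phi x -> local_rep f x phi psi F -> local_rep g (f x) psi chi G ->
  local_rep (g \o f) x phi chi H ->
  forall v, 'd H (cmap phi x) v =
            'd G (cmap psi (f x)) ('d F (cmap phi x) v).
Proof.
move=> hx hF hG hH v.
have hGF := local_rep_comp hx hF hG.
rewrite (congr1 (fun h => h v) (local_rep_diff_unique hGF hH)).
have E := (local_rep_at hx hF).2.
have dG := local_rep_diff hG.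
rewrite E in dG *.
by have := diff_comp (local_rep_diff hF) dG => /(congr1 (fun h => h v)).
Qed.

(** The same function represents f at all points near x; this makes the
    differential of f computable on a whole neighbourhood. *)
Lemma local_rep_nearby (X Y : Type) n k (f : X -> Y) x (phi : chart R X n)
    (psi : chart R Y k) F : local_rep f x phi psi F ->
  chart_near phi x (fun y => cdom phi y -> local_rep f y phi psi F).
Proof.
move=> [W [oW Wx Wi sF WF]]; exists W; split=> // y hy Wy _.
by exists W.
Qed.

Section OneSpace.
Variables (X : charted R).
Hypothesis aX : has_atlas X.
Variable x : X.
Implicit Types (v w : tangent x) (phi psi : chart R X (mdim X)).

Lemma tangent_coordsP v : (forall phi, ~ chart_at x phi -> v phi = 0) /\
    forall phi psi F, chart_at x phi -> chart_at x psi ->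
      local_rep id x phi psi F -> v psi = 'd F (cmap phi x) (v phi).
Proof. by case: v => v' /= /asboolP. Qed.

Lemma tangent_ext v w phi : chart_at x phi -> v phi = w phi -> v = w.
Proof.
move=> hphi vw; apply: val_inj; apply/funext => psi /=.
have [v0 vD] := tangent_coordsP v; have [w0 wD] := tangent_coordsP w.
have [hpsi|npsi] := pselect (chart_at x psi); last by rewrite v0 ?w0.
have [_ _ tr] := aX; have [F hF] := tr _ _ hphi.1 hpsi.1 x hphi.2 hpsi.2.
by rewrite (vD _ _ _ hphi hpsi hF) (wD _ _ _ hphi hpsi hF) vw.
Qed.

Lemma tcoordP (a : R) v w phi : (a *: v + w) phi = a *: v phi + w phi.
Proof. by []. Qed.

(** The differentials of the transition maps out of phi spread a coordinate
    vector to all charts, and the chain rule makes the result compatible. *)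
Lemma tangent_of_coord phi (c : 'rV[R]_(mdim X)) : chart_at x phi ->
  exists v : tangent x, v phi = c.
Proof.
move=> hphi.
have /choice[T TP] : forall psi, exists F,
    chart_at x psi -> local_rep id x phi psi F.
  move=> psi; have [hpsi|] := pselect (chart_at x psi); last by exists id.
  have [_ _ tr] := aX.
  by have [F hF] := tr _ _ hphi.1 hpsi.1 x hphi.2 hpsi.2; exists F.
pose v psi := if pselect (chart_at x psi) then 'd (T psi) (cmap phi x) c else 0.
have vE psi : chart_at x psi -> v psi = 'd (T psi) (cmap phi x) c.
  by move=> hpsi; rewrite /v; case: pselect.
have vc : v \in @tangent_compat R X x.
  apply/asboolP; split=> [psi npsi|psi psi' F hpsi hpsi' hF].
    by rewrite /v; case: pselect.
  rewrite (vE _ hpsi) (vE _ hpsi').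
  exact: (local_rep_diff_comp (f := id) (g := id) hphi.2 (TP _ hpsi) hF (TP _ hpsi')).
exists (Tangent vc); rewrite /= (vE _ hphi).
have hid := local_rep_id (atlas_near aX hphi).
rewrite (congr1 (fun h => h c) (local_rep_diff_unique hid (TP _ hphi))).
by rewrite (congr1 (fun h => h c) (diff_linear (@idfun 'rV[R]_(mdim X)) _)).
Qed.

End OneSpace.

(** The vector with the right coordinates in one pair of charts has them in
    every pair, by the chain rule; so the choice in the definition of the tangent
    map is made from a nonempty set. *)
Lemma tmap_coord X Y (f : X -> Y) x (v : tangent x) phi psi F :
  has_atlas X -> has_atlas Y -> chart_at x phi -> chart_at (f x) psi ->
  local_rep f x phi psi F -> tmap f v psi = 'd F (cmap phi x) (v phi).
Proof.
move=> aX aY hphi hpsi hF.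
have [w wE] := tangent_of_coord aY ('d F (cmap phi x) (v phi)) hpsi.
have wS : [set w : tangent (f x) | forall phi psi F,
    chart_at x phi -> chart_at (f x) psi -> local_rep f x phi psi F ->
    w psi = 'd F (cmap phi x) (v phi)] w.
  move=> phi' psi' F' hphi' hpsi' hF'.
  have [_ _ trX] := aX; have [_ _ trY] := aY.
  have [P hP] := trX _ _ hphi.1 hphi'.1 x hphi.2 hphi'.2.
  have [Q hQ] := trY _ _ hpsi.1 hpsi'.1 _ hpsi.2 hpsi'.2.
  rewrite ((tangent_coordsP w).2 _ _ _ hpsi hpsi' hQ) wE.
  rewrite ((tangent_coordsP v).2 _ _ _ hphi hphi' hP).
  have hQF : local_rep f x phi psi' (Q \o F).
    exact: (local_rep_comp (g := id) hphi.2 hF hQ).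
  rewrite -(local_rep_diff_comp (g := id) hphi.2 hF hQ hQF).
  exact: (local_rep_diff_comp (f := id) (g := f) hphi.2 hP hF' hQF).
by rewrite /tmap; case: xgetP => [u -> uS|/(_ w)//]; exact: uS.
Qed.

Lemma tmap_linear X Y (f : X -> Y) x : has_atlas X -> has_atlas Y ->
  smooth_at f x -> linear (@tmap R X Y f x).
Proof.
move=> aX aY sf a v w.
have [phi hphi] := atlas_cover aX x; have [psi hpsi] := atlas_cover aY (f x).
have [F hF] := smooth_at_local_rep aX aY sf hphi hpsi.
apply: (tangent_ext aY hpsi); rewrite tcoordP.
by rewrite !(tmap_coord _ aX aY hphi hpsi hF) tcoordP linearP.
Qed.

Lemma tmap_id X x (v : tangent (x : X)) : has_atlas X -> tmap id v = v.
Proof.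
move=> aX; have [phi hphi] := atlas_cover aX x.
have hid := local_rep_id (atlas_near aX hphi).
apply: (tangent_ext aX hphi); rewrite (tmap_coord _ aX aX hphi hphi hid).
by rewrite (congr1 (fun h => h (v phi)) (diff_linear (@idfun 'rV[R]_(mdim X)) _)).
Qed.

Lemma tmap_comp X Y Z (f : X -> Y) (g : Y -> Z) x (v : tangent x) :
  has_atlas X -> has_atlas Y -> has_atlas Z ->
  smooth_at f x -> smooth_at g (f x) ->
  tmap (g \o f) v = tmap g (tmap f v).
Proof.
move=> aX aY aZ sf sg.
have [phi hphi] := atlas_cover aX x; have [psi hpsi] := atlas_cover aY (f x).
have [chi hchi] := atlas_cover aZ (g (f x)).
have [F hF] := smooth_at_local_rep aX aY sf hphi hpsi.
have [G hG] := smooth_at_local_rep aY aZ sg hpsi hchi.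
have hGF := local_rep_comp hphi.2 hF hG.
apply: (tangent_ext aZ hchi).
rewrite (tmap_coord _ aX aZ hphi hchi hGF) (tmap_coord _ aY aZ hpsi hchi hG).
rewrite (tmap_coord _ aX aY hphi hpsi hF).
exact: local_rep_diff_comp hphi.2 hF hG hGF _.
Qed.

End TangentVectors.

(** * The tangent bundle *)

Section TangentBundle.
Context {R : realType}.
Implicit Types X Y Z : charted R.

Definition chart_triv X (phi : chart R X (mdim X)) :
    set X * (forall x, tangent_bundle X x -> 'rV[R]_(vrank (tangent_bundle X))) :=
  (cdom phi, fun x (v : tangent x) => v phi).

Lemma chart_triv_trivs X (phi : chart R X (mdim X)) :
  atlas phi -> trivs (v := tangent_bundle X) (chart_triv phi).
Proof. by move=> a; exists phi. Qed.

Lemma mxvec_lin1_sum n k (L : {linear 'rV[R]_n -> 'rV[R]_k}) :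
  mxvec (lin1_mx L) =
  \sum_i mxvec (delta_mx i (0 : 'I_1) *m L (delta_mx 0 i)).
Proof.
rewrite -linear_sum; congr mxvec; apply/matrixP => i j.
rewrite summxE (bigD1 i)//= big1 ?addr0.
  by rewrite !mxE big_ord1 !mxE !eqxx mul1r.
by move=> l nl; rewrite mxE big_ord1 mxE eq_sym (negPf nl) mul0r.
Qed.

(** The transition matrix at y is the Jacobian of a representative chosen at
    y. A representative chosen at x serves for all y near x, which gives the
    smoothness of the matrix. *)
Lemma tangent_vbundle X : has_atlas X -> is_vbundle (tangent_bundle X).
Proof.
move=> aX; have [cov inj tr] := aX; split.
- move=> _ [phi a ->]; split=> [psi b|x /= hx].
    rewrite openE => _ [x [hx hx'] <-].
    have [F [W [oW Wx Wi _ WF]]] := tr _ _ b a x hx' hx.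
    apply: filterS (open_nbhs_nbhs (conj oW Wx)) => c Wc.
    have [z hz zc] := Wi c Wc; rewrite -zc in Wc.
    by exists z => //; split=> //; exact: (WF z hz Wc).1.
  have hphi : chart_at x phi by [].
  split; first by move=> r v w; exact: tcoordP.
  pose inv c := xget 0 [set v : tangent x | v phi = c].
  have invK : cancel inv (fun v : tangent x => v phi).
    move=> c; rewrite /inv; case: xgetP => [v -> //|].
    by have [v vc] := tangent_of_coord aX c hphi => /(_ v).
  by exists inv => // v; apply: (tangent_ext aX hphi); exact: invK.
- move=> x; have [phi [a h]] := cov x.
  by exists (chart_triv phi) => //; exact: chart_triv_trivs.
- move=> _ _ [phi a ->] [psi b ->] /=.
  have /choice[T T_rep] : forall y, exists F,
      cdom phi y -> cdom psi y -> local_rep id y phi psi F.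
    move=> y; have [hy|] := pselect (cdom phi y); last by exists id.
    have [hy'|] := pselect (cdom psi y); last by exists id.
    by have [F hF] := tr _ _ a b y hy hy'; exists F.
  have TP y F : cdom phi y -> local_rep id y phi psi F ->
      'd (T y) (cmap phi y) = 'd F (cmap phi y) :> (_ -> _).
    move=> hy hF; apply: (local_rep_diff_unique hF).
    by apply: T_rep => //; exact: (local_rep_at hy hF).1.
  exists (fun y => lin1_mx ('d (T y) (cmap phi y))); split=> [x hx hx'|x e hx hx'].
    have hphi : chart_at x phi by [].
    have hpsi : chart_at x psi by [].
    have [F hF] := tr _ _ a b x hx hx'.
    apply/(smooth_at_euclidean _ aX hphi).
    apply: (chart_smooth_eq (f := fun y =>
       \sum_i mxvec (delta_mx i (0 : 'I_1) *m 'd F (cmap phi y) (delta_mx 0 i)))).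
      have [W [oW Wx Wi WP]] := local_rep_nearby hF.
      exists W; split=> // y hy Wy.
      rewrite mxvec_lin1_sum; apply: eq_bigr => i _.
      exact/esym/(congr1 (fun h => mxvec (delta_mx i 0 *m h (delta_mx 0 i)))
        (TP y F hy (WP y hy Wy hy))).
    apply: chart_smooth_sum => [|i]; first exact: atlas_near aX hphi.
    apply: (chart_smooth_linear
      (L := fun u => mxvec (delta_mx i (0 : 'I_1) *m u))
      (f := fun y => 'd F (cmap phi y) (delta_mx 0 i))) => //.
      by move=> r u v; rewrite mulmxDr -scalemxAr linearP.
    case: hF => W [oW Wx Wi sF WF].
    exists (fun c => 'd F c (delta_mx 0 i)), W; split=> // r.
    exact: (sF r.+1).2.
  have hphi : chart_at x phi by [].
  have hpsi : chart_at x psi by [].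
  have [F hF] := tr _ _ a b x hx hx'.
  rewrite mul_rV_lin1 ((tangent_coordsP e).2 _ _ _ hphi hpsi hF).
  exact/esym/(congr1 (fun h => h (e phi)) (TP x F hx hF)).
Qed.

(** In coordinates the map is (x, v) |-> (F x, sum_i v_i d_i F(x)). *)
Lemma smooth_total_tmap X Y (f : X -> Y) : has_atlas X -> has_atlas Y ->
  smooth f ->
  smooth (@total_map R X Y (tangent_bundle X) (tangent_bundle Y) f
            (fun x v => tmap f v)).
Proof.
move=> aX aY sf e; set h := total_map _.
have bX := tangent_vbundle aX; have bY := tangent_vbundle aY.
have [phi hphi] := atlas_cover aX (tag e).
have [psi hpsi] := atlas_cover aY (f (tag e)).
have hU := chart_triv_trivs hpsi.1.
have hphi' : chart_at e (total_chart phi (chart_triv phi) :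
    chart R (total_space (tangent_bundle X)) _).
  split; first by exists phi, (chart_triv phi); split;
    [exact: hphi.1|exact: chart_triv_trivs hphi.1|].
  by split; exact: hphi.2.
apply/(smooth_at_total aY bY (total_atlas aX bX) hphi' hU); first exact: hpsi.2.
split.
  exact: (smooth_comp aX (smooth_tag aX bX) sf).
have [F hF] := smooth_at_local_rep aX aY (sf (tag e)) hphi hpsi.
have htag := local_rep_tag (E := tangent_bundle X) aX bX hphi
  (chart_triv_trivs hphi.1) hphi.2.
apply: (chart_smooth_eq (f := fun z : total_space (tangent_bundle X) =>
  \sum_i fibre_coord (chart_triv phi) z 0 i *:
    'd F (cmap phi (tag z)) (delta_mx 0 i))).
  have := chart_near_comp hphi'.2 htag (chart_nearI (local_rep_nearby hF)
    (local_rep_near hF)).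
  move=> [W [oW We Wi WP]]; exists W; split=> // z hz Wz.
  have [hFz hpz] := WP z hz Wz; have {}hFz := hFz hz.1.
  have hphiz : chart_at (tag z) phi by split; [exact: hphi.1|exact: hz.1].
  have hpsiz : chart_at (f (tag z)) psi by split; [exact: hpsi.1|].
  rewrite /h /fibre_coord /= (tmap_coord _ aX aY hphiz hpsiz hFz).
  rewrite [in RHS](row_sum_delta (tagged z phi)) linear_sum.
  by apply: eq_bigr => i _; rewrite linearZ.
apply: chart_smooth_sum => [|i].
  exact: atlas_near (total_atlas aX bX) hphi'.
apply: chart_smoothZ.
  exact: (fibre_coord_smooth aX bX hphi (chart_triv_trivs hphi.1) hphi.2).
apply: (chart_smooth_comp (f := @tag _ _)
  (g := fun y => 'd F (cmap phi y) (delta_mx 0 i)) hphi'.2 htag).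
case: hF => W [oW Wx Wi sF WF].
exists (fun c => 'd F c (delta_mx 0 i)), W; split=> // r.
exact: (sF r.+1).2.
Qed.

End TangentBundle.

(** * Smooth vector bundle maps *)

Section BundleMaps.
Context {R : realType}.
Implicit Types X Y Z : charted R.

Lemma total_chart_at X (E : vbundle X) (e : total_space E) phi tau :
  chart_at (tag e) phi -> trivs (v := E) tau -> tau.1 (tag e) ->
  chart_at e (total_chart phi tau : chart R (total_space E) _).
Proof.
move=> hphi htau Ue; split; last by split; [exact: hphi.2|].
by exists phi, tau; split=> //; exact: hphi.1.
Qed.

Lemma smooth_total_map_at X Y (E : vbundle X) (E' : vbundle Y) (f : X -> Y)
    (F : forall x, E x -> E' (f x)) (e : total_space E) phi sigma tau :
  has_atlas X -> has_atlas Y -> is_vbundle E -> is_vbundle E' -> smooth f ->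
  chart_at (tag e) phi -> trivs (v := E) sigma -> sigma.1 (tag e) ->
  trivs (v := E') tau -> tau.1 (f (tag e)) ->
  smooth_at (total_map F) e <->
  chart_smooth (total_chart phi sigma) e (fibre_coord tau \o total_map F).
Proof.
move=> aX aY bE bE' sf hphi hs Us ht Ut.
have hchi := total_chart_at hphi hs Us.
have aE := total_atlas aX bE.
have tot := smooth_at_total (h := total_map F) aY bE' aE hchi ht Ut.
split=> [/tot[]//|sF]; apply/tot; split=> //.
exact: (smooth_comp aX (smooth_tag aX bE) sf).
Qed.

Section Whitney.
Variables (X : charted R) (E1 E2 : vbundle X).
Hypotheses (aX : has_atlas X) (b1 : is_vbundle E1) (b2 : is_vbundle E2).

Definition whitney_triv
    (s1 : set X * (forall x, E1 x -> 'rV[R]_(vrank E1)))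
    (s2 : set X * (forall x, E2 x -> 'rV[R]_(vrank E2))) :
    set X * (forall x, whitney_sum E1 E2 x ->
                       'rV[R]_(vrank (whitney_sum E1 E2))) :=
  (s1.1 `&` s2.1, fun x (e : E1 x * E2 x) => row_mx (s1.2 x e.1) (s2.2 x e.2)).

Lemma whitney_triv_trivs s1 s2 : trivs (v := E1) s1 -> trivs (v := E2) s2 ->
  trivs (v := whitney_sum E1 E2) (whitney_triv s1 s2).
Proof. by move=> h1 h2; exists s1, s2. Qed.

(** The coordinate image of an intersection is the intersection of the images
    because charts are injective. *)
Lemma mopenI (U V : set X) : mopen U -> mopen V -> mopen (U `&` V).
Proof.
move=> oU oV phi a; have [_ inj _] := aX.
have -> : cmap phi @` (U `&` V `&` cdom phi) =
    (cmap phi @` (U `&` cdom phi)) `&` (cmap phi @` (V `&` cdom phi)).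
  apply/seteqP; split=> [_ [x [[Ux Vx] hx] <-]|].
    by split; exists x.
  move=> _ [[x [Ux hx] <-] [y [Vy hy] yx]].
  by exists x => //; split=> //; split=> //; rewrite -(inj _ a _ _ hy hx yx).
by apply: openI; [exact: oU|exact: oV].
Qed.

Lemma whitney_vbundle : is_vbundle (whitney_sum E1 E2).
Proof.
have [tr1 cov1 g1] := b1; have [tr2 cov2 g2] := b2; split.
- move=> _ [s1 [s2 [h1 h2 ->]]] /=.
  have [op1 l1] := tr1 _ h1; have [op2 l2] := tr2 _ h2.
  split=> [|x [/l1[lin1 [k1 k1K k1K']] /l2[lin2 [k2 k2K k2K']]]].
    exact: mopenI.
  split=> [a [u1 u2] [v1 v2]|].
    by rewrite /= lin1 lin2 -add_row_mx -scale_row_mx.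
  exists (fun c => (k1 (lsubmx c), k2 (rsubmx c))) => [[u1 u2]|c] /=.
    by rewrite row_mxKl row_mxKr k1K k2K.
  by rewrite k1K' k2K' hsubmxK.
- move=> x; have [s1 h1 U1] := cov1 x; have [s2 h2 U2] := cov2 x.
  by exists (whitney_triv s1 s2) => //; exact: whitney_triv_trivs.
- move=> _ _ [s1 [s2 [h1 h2 ->]]] [s1' [s2' [h1' h2' ->]]] /=.
  have [A [sA EA]] := g1 _ _ h1 h1'; have [B [sB EB]] := g2 _ _ h2 h2'.
  exists (fun x => block_mx (A x) 0 0 (B x)); split.
    move=> x [U1 U2] [U1' U2']; have [phi hphi] := atlas_cover aX x.
    have cA := (smooth_at_euclidean _ aX hphi).1 (sA x U1 U1').
    have cB := (smooth_at_euclidean _ aX hphi).1 (sB x U2 U2').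
    apply/(smooth_at_euclidean _ aX hphi).
    pose LA (u : 'rV[R]_(vrank E1 * vrank E1)) :=
      mxvec (block_mx (vec_mx u) 0 0 (0 : 'M[R]_(vrank E2))).
    pose LB (u : 'rV[R]_(vrank E2 * vrank E2)) :=
      mxvec (block_mx (0 : 'M[R]_(vrank E1)) 0 0 (vec_mx u)).
    have -> : (fun y => mxvec (block_mx (A y) 0 0 (B y))) =
        fun y => LA (mxvec (A y)) + LB (mxvec (B y)).
      apply/funext => y.
      by rewrite /LA /LB !mxvecK -linearD add_block_mx !addr0 !add0r.
    apply: chart_smoothD.
      apply: (chart_smooth_linear (L := LA) _ hphi.2 cA) => a u v.
      rewrite /LA -linearP scale_block_mx add_block_mx !scaler0 !addr0.
      by rewrite [vec_mx (_ + _)]linearP.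
    apply: (chart_smooth_linear (L := LB) _ hphi.2 cB) => a u v.
    rewrite /LB -linearP scale_block_mx add_block_mx !scaler0 !addr0.
    by rewrite [vec_mx (_ + _)]linearP.
  move=> x [e1 e2] [U1 U2] [U1' U2'] /=.
  rewrite (EA _ _ U1 U1') (EB _ _ U2 U2') mul_row_block.
  by rewrite !mulmx0 addr0 add0r.
Qed.

Lemma smooth_whitney_fst :
  smooth (@total_map R X X (whitney_sum E1 E2) E1 id (fun x e => e.1)).
Proof.
have [_ cov1 _] := b1; have [_ cov2 _] := b2.
move=> e; have [phi hphi] := atlas_cover aX (tag e).
have [s1 h1 U1] := cov1 (tag e); have [s2 h2 U2] := cov2 (tag e).
have hw := whitney_triv_trivs h1 h2.
have Uw : (whitney_triv s1 s2).1 (tag e) by [].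
apply/(smooth_total_map_at _ aX aX whitney_vbundle b1 (smooth_id aX) hphi hw Uw h1 U1).
have -> : fibre_coord s1 \o @total_map R X X (whitney_sum E1 E2) E1 id (fun x e => e.1)
    = lsubmx \o (fibre_coord (whitney_triv s1 s2)).
  by apply/funext => z; rewrite /fibre_coord /= row_mxKl.
apply: chart_smooth_linear; first exact: linearP.
  by split; [exact: hphi.2|].
exact: (fibre_coord_smooth aX whitney_vbundle hphi hw Uw).
Qed.

Lemma smooth_whitney_snd :
  smooth (@total_map R X X (whitney_sum E1 E2) E2 id (fun x e => e.2)).
Proof.
have [_ cov1 _] := b1; have [_ cov2 _] := b2.
move=> e; have [phi hphi] := atlas_cover aX (tag e).
have [s1 h1 U1] := cov1 (tag e); have [s2 h2 U2] := cov2 (tag e).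
have hw := whitney_triv_trivs h1 h2.
have Uw : (whitney_triv s1 s2).1 (tag e) by [].
apply/(smooth_total_map_at _ aX aX whitney_vbundle b2 (smooth_id aX) hphi hw Uw h2 U2).
have -> : fibre_coord s2 \o @total_map R X X (whitney_sum E1 E2) E2 id (fun x e => e.2)
    = rsubmx \o (fibre_coord (whitney_triv s1 s2)).
  by apply/funext => z; rewrite /fibre_coord /= row_mxKr.
apply: chart_smooth_linear; first exact: linearP.
  by split; [exact: hphi.2|].
exact: (fibre_coord_smooth aX whitney_vbundle hphi hw Uw).
Qed.

End Whitney.

Section Maps.
Variables (X Y : charted R) (E : vbundle X) (f : X -> Y).
Hypotheses (aX : has_atlas X) (aY : has_atlas Y) (bE : is_vbundle E).
Hypothesis sf : smooth f.

Lemma smooth_whitney_pair (E1 E2 : vbundle Y)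
    (A : forall x, E x -> E1 (f x)) (B : forall x, E x -> E2 (f x)) :
  is_vbundle E1 -> is_vbundle E2 ->
  smooth (total_map A) -> smooth (total_map B) ->
  smooth (@total_map R X Y E (whitney_sum E1 E2) f (fun x e => (A x e, B x e))).
Proof.
move=> b1 b2 sA sB e; have [phi hphi] := atlas_cover aX (tag e).
have [_ cov _] := bE; have [s hs Us] := cov (tag e).
have [_ cov1 _] := b1; have [_ cov2 _] := b2.
have [s1 h1 U1] := cov1 (f (tag e)); have [s2 h2 U2] := cov2 (f (tag e)).
have hw := whitney_triv_trivs h1 h2.
have Uw : (whitney_triv s1 s2).1 (f (tag e)) by [].
apply/(smooth_total_map_at _ aX aY bE (whitney_vbundle aY b1 b2) sf hphi hs Us hw Uw).
apply: (chart_smooth_row (f := fibre_coord s1 \o total_map A)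
  (g := fibre_coord s2 \o total_map B)); first by split; [exact: hphi.2|].
  exact/(smooth_total_map_at _ aX aY bE b1 sf hphi hs Us h1 U1)/sA.
exact/(smooth_total_map_at _ aX aY bE b2 sf hphi hs Us h2 U2)/sB.
Qed.

Lemma smooth_bundleD (E1 : vbundle Y) (A B : forall x, E x -> E1 (f x)) :
  is_vbundle E1 -> smooth (total_map A) -> smooth (total_map B) ->
  smooth (total_map (fun x e => A x e + B x e)).
Proof.
move=> b1 sA sB e; have [phi hphi] := atlas_cover aX (tag e).
have [_ cov _] := bE; have [s hs Us] := cov (tag e).
have [tr1 cov1 _] := b1; have [t ht Ut] := cov1 (f (tag e)).
have hchi := total_chart_at hphi hs Us.
apply/(smooth_total_map_at _ aX aY bE b1 sf hphi hs Us ht Ut).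
apply: (chart_smooth_eq (f := fun z => (fibre_coord t \o total_map A) z +
                                      (fibre_coord t \o total_map B) z)).
  have [psi hpsi] := atlas_cover aY (f (tag e)).
  have [F hF] := smooth_at_local_rep aX aY (sf (tag e)) hphi hpsi.
  have hF' := local_rep_comp hchi.2 (local_rep_tag aX bE hphi hs Us) hF.
  apply: chart_nearS (chart_near_comp hchi.2 hF' (triv_near aY b1 hpsi ht Ut)).
  move=> z /= Uz; have [_ /(_ _ Uz)[lt _]] := tr1 _ ht.
  have [g gE] := linear_bundle lt.
  by rewrite /fibre_coord /= -gE linearD.
apply: chart_smoothD.
  exact/(smooth_total_map_at _ aX aY bE b1 sf hphi hs Us ht Ut)/sA.
exact/(smooth_total_map_at _ aX aY bE b1 sf hphi hs Us ht Ut)/sB.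
Qed.

Lemma row_rank1_const k (i : 'I_k) (u : 'rV[R]_k) : k = 1%N -> u = const_mx (u 0 i).
Proof.
by move=> k1; subst k; apply/rowP => j; rewrite mxE !ord1.
Qed.

(** C is the quotient of A by the fibrewise isomorphism B. On line bundles, B
    multiplies by a nowhere vanishing function b, which is read off on a local
    frame of E1; so C is a / b in coordinates. *)
Lemma smooth_bundle_div (E1 : vbundle X) (E2 : vbundle Y)
    (A : forall x, E x -> E2 (f x)) (B : forall x, E1 x -> E2 (f x))
    (C : forall x, E x -> E1 x) :
  is_vbundle E1 -> is_vbundle E2 -> vrank E1 = 1%N -> vrank E2 = 1%N ->
  smooth (total_map A) -> smooth (total_map B) ->
  (forall x, linear (B x) /\ injective (B x)) ->
  (forall x e, B x (C x e) = A x e) ->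
  smooth (@total_map R X X E E1 id C).
Proof.
move=> b1 b2 r1 r2 sA sB linB BC e.
have [phi hphi] := atlas_cover aX (tag e).
have [_ cov _] := bE; have [s hs Us] := cov (tag e).
have [tr1 cov1 _] := b1; have [t ht Ut] := cov1 (tag e).
have [tr2 cov2 _] := b2; have [t2 ht2 Ut2] := cov2 (f (tag e)).
have hchi := total_chart_at hphi hs Us.
pose i1 : 'I_(vrank E1) := cast_ord (esym r1) ord0.
pose i2 : 'I_(vrank E2) := cast_ord (esym r2) ord0.
(* A frame of E1 over t.1. *)
pose s1 x : E1 x := xget 0 [set l | t.2 x l = const_mx 1].
have s1P x : t.1 x -> t.2 x (s1 x) = const_mx 1.
  move=> /((tr1 _ ht).2)[_ [k _ kK]]; rewrite /s1; case: xgetP => [l -> //|].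
  by move=> /(_ (k (const_mx 1))); rewrite /= kK.
pose sec (x : X) : total_space E1 := point_in (s1 x).
have ssec : smooth_at sec (tag e).
  apply/(smooth_at_total (h := sec) aX b1 aX hphi ht Ut); split; first exact: smooth_id.
  apply: (chart_smooth_eq (f := fun=> const_mx 1)).
    by apply: chart_nearS (triv_near aX b1 hphi ht Ut) => x /s1P.
  exact/chart_smooth_cst/(atlas_near aX hphi).
pose b (x : X) := t2.2 (f x) (B x (s1 x)).
have sb : chart_smooth phi (tag e) b.
  have := smooth_at_comp (total_atlas aX b1) ssec (sB (sec (tag e))).
  by move/(smooth_at_total (h := total_map B \o sec) aY b2 aX hphi ht2 Ut2) => [].
have Bscale x (a : R) l : B x (a *: l) = a *: B x l.
  by have [g <-] := linear_bundle (linB x).1; rewrite linearZ.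
have b_neq0 x : t.1 x -> t2.1 (f x) -> b x 0 i2 != 0.
  move=> Ux Ux2; apply/eqP => bx0.
  have [/linear_bundle[g gE] /bij_inj injg] := (tr2 _ ht2).2 _ Ux2.
  have : b x = t2.2 (f x) (B x 0).
    rewrite (row_rank1_const i2 (b x) r2) bx0 -[in RHS](scale0r (s1 x)) Bscale.
    by rewrite scale0r -gE linear0; apply/rowP => j; rewrite !mxE.
  move=> /injg/(linB x).2 s10; have := s1P x Ux.
  have [/linear_bundle[h hE] _] := (tr1 _ ht).2 _ Ux.
  rewrite s10 -hE linear0 => /rowP /(_ i1); rewrite !mxE => /esym/eqP.
  by rewrite oner_eq0.
apply/(smooth_total_map_at _ aX aX bE b1 (smooth_id aX) hphi hs Us ht Ut).
pose a (z : total_space E) := (fibre_coord t2 \o total_map A) z.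
have sa : chart_smooth (total_chart phi s) e a.
  exact/(smooth_total_map_at _ aX aY bE b2 sf hphi hs Us ht2 Ut2)/sA.
have htag := local_rep_tag aX bE hphi hs Us.
apply: (chart_smooth_eq (f := (fun u : 'rV[R]_1 => const_mx (u 0 0)) \o
  (fun z : total_space E => a z 0 i2 *: (const_mx (b (tag z) 0 i2)^-1 : 'rV[R]_1)))).
  have [psi hpsi] := atlas_cover aY (f (tag e)).
  have [F hF] := smooth_at_local_rep aX aY (sf (tag e)) hphi hpsi.
  have hF' := local_rep_comp hchi.2 htag hF.
  apply: chart_nearS (chart_nearI
    (chart_near_comp hchi.2 hF' (triv_near aY b2 hpsi ht2 Ut2))
    (chart_near_comp hchi.2 htag (triv_near aX b1 hphi ht Ut))).
  move=> z /= [Uz2 Uz]; rewrite /fibre_coord /=.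
  set c := t.2 _ _.
  have cE := row_rank1_const i1 c r1.
  have [/linear_bundle[h hE] /bij_inj injh] := (tr1 _ ht).2 _ Uz.
  have Cc : C (tag z) (tagged z) = c 0 i1 *: s1 (tag z).
    apply: injh; rewrite -hE linearZ /= hE s1P // -/c {1}cE.
    by apply/rowP => j; rewrite !mxE mulr1.
  have [/linear_bundle[g gE] _] := (tr2 _ ht2).2 _ Uz2.
  have -> : a z = c 0 i1 *: b (tag z).
    by rewrite /a /fibre_coord /= -BC Cc Bscale -gE linearZ /= gE.
  by rewrite [RHS]cE !mxE mulfK// b_neq0.
apply: chart_smooth_linear; last first.
- apply: chart_smoothZ => //.
  apply: (chart_smooth_comp (f := @tag _ _)
    (g := fun x => const_mx (b x 0 i2)^-1 : 'rV[R]_1) hchi.2 htag).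
  by apply: chart_smoothV => //; [exact: hphi.2|exact: b_neq0].
- exact: hchi.2.
- by move=> k u v; apply/rowP => j; rewrite !mxE.
Qed.

End Maps.
End BundleMaps.

(** * Submersions and tangent vectors of fibre products *)

Section Submersions.
Context {R : realType}.
Implicit Types X Y Z : charted R.

Lemma diff_linear_fun n k (L : 'rV[R]_n -> 'rV[R]_k) c v :
  linear L -> 'd L c v = L v.
Proof.
by move=> /linear_bundle[g <-]; exact: (congr1 (fun h => h v) (diff_linear g c)).
Qed.

Lemma submersion_coord X Y (f : X -> Y) x phi psi F (w : 'rV[R]_(mdim Y)) :
  has_atlas X -> has_atlas Y -> submersion f ->
  chart_at x phi -> chart_at (f x) psi -> local_rep f x phi psi F ->
  exists a, 'd F (cmap phi x) a = w.
Proof.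
move=> aX aY [_ df] hphi hpsi hF.
have [t <-] := tangent_of_coord aY w hpsi; have [v <-] := df x t.
by exists (v phi); rewrite (tmap_coord _ aX aY hphi hpsi hF).
Qed.

Lemma row_affine_is_diff n k l (c : 'rV[R]_k)
    (L : {linear 'rV[R]_n -> 'rV[R]_l}) (b : 'rV[R]_n) :
  is_diff b (fun y => row_mx c (L y)) (fun v => row_mx 0 (L v)).
Proof.
pose g y : 'rV[R]_(k + l) := row_mx 0 (L y).
have lg : linear g.
  by move=> a u v; rewrite /g linearP -[in LHS](scaler0 _ a) -[in LHS](addr0 (a *: 0))
    -add_row_mx -scale_row_mx.
pose G : {linear 'rV[R]_n -> 'rV[R]_(k + l)} :=
  HB.pack g (GRing.isLinear.Build _ _ _ _ g lg).
have DG : is_diff b g g.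
  exact: DiffDef (differentiable_linear G b) (diff_linear G b).
have E1 : cst (row_mx c 0) + g = (fun y => row_mx c (L y)).
  by apply/funext => y; rewrite fctE /= /g add_row_mx addr0 add0r.
have E2 : 0 + g = (fun v => row_mx 0 (L v)) by rewrite add0r.
by rewrite -E1 -E2; apply: is_diffD.
Qed.

(** In coordinates the map is (x, e) |-> (f x, A_x e) with A_x linear, so its
    differential is block triangular, with the surjective maps df and A_x on the
    diagonal. The off-diagonal block is corrected by the choice of the fibre
    component, hence need not be computed. *)
Lemma total_map_submersion X Y (E : vbundle X) (E' : vbundle Y) (f : X -> Y)
    (F : forall x, E x -> E' (f x)) :
  has_atlas X -> has_atlas Y -> is_vbundle E -> is_vbundle E' ->
  submersion f -> smooth (total_map F) ->
  (forall x, linear (F x) /\ forall e', exists e, F x e = e') ->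
  submersion (total_map F).
Proof.
move=> aX aY bE bE' subf sF linF; split=> // e w; have [sf _] := subf.
have aE := total_atlas aX bE; have aE' := total_atlas aY bE'.
have [phi hphi] := atlas_cover aX (tag e).
have [psi hpsi] := atlas_cover aY (f (tag e)).
have [tr cov _] := bE; have [s hs Us] := cov (tag e).
have [tr' cov' _] := bE'; have [t ht Ut] := cov' (f (tag e)).
have hchi := total_chart_at hphi hs Us.
have hchi' : chart_at (total_map F e) (total_chart psi t : chart R (total_space E') _).
  exact: total_chart_at.
have [H hH] := smooth_at_local_rep aE aE' (sF e) hchi hchi'.
have [C hC] := smooth_at_local_rep aX aY (sf (tag e)) hphi hpsi.
have htag := local_rep_tag aX bE hphi hs Us.
have htag' := local_rep_tag (e := total_map F e) aY bE' hpsi ht Ut.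
have dlsub k l (c v : 'rV[R]_(k + l)) :
    'd (lsubmx : 'rV[R]_(k + l) -> 'rV[R]_k) c v = lsubmx v.
  exact: (congr1 (fun h => h v) (diff_linear (@lsubmx R 1 k l) c)).
have base c : lsubmx ('d H (cmap (total_chart phi s) e) c) =
    'd C (cmap phi (tag e)) (lsubmx c).
  have hCt : local_rep (f \o @tag _ _) e (total_chart phi s) psi (C \o lsubmx).
    exact: local_rep_comp hchi.2 htag hC.
  have E1 := local_rep_diff_comp hchi.2 htag hC hCt c.
  have E2 := local_rep_diff_comp (f := total_map F) (g := @tag _ _)
    hchi.2 hH htag' hCt c.
  by rewrite -[LHS](dlsub _ _ (cmap (total_chart psi t) (total_map F e))) -E2 E1 dlsub.
have [ls [k sK kK]] := (tr _ hs).2 _ Us.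
have [lt [k' tK kK']] := (tr' _ ht).2 _ Ut.
have [lF surF] := linF (tag e).
pose A c := t.2 _ (F (tag e) (k c)).
have lk : linear k.
  have [g gE] := linear_bundle ls.
  by move=> a u v; apply: (can_inj sK); rewrite kK -gE linearP /= gE !kK.
have lA : linear A by move=> a u v; rewrite /A lk lF lt.
have [A' A'E] := linear_bundle lA.
have surA c : exists b, A b = c.
  have [e' e'E] := surF (k' c); exists (s.2 _ e').
  by rewrite /A sK e'E kK'.
have fibre b : 'd H (cmap (total_chart phi s) e) (row_mx 0 b) = row_mx 0 (A b).
  have hdom := hchi.2.
  case: (hH) => W [oW We Wi sH WH].
  pose x0 := cmap phi (tag e); pose b0 := s.2 _ (tagged e).
  pose j (y : 'rV[R]_(vrank E)) := row_mx x0 y.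
  have Dj := row_affine_is_diff x0 (@idfun 'rV[R]_(vrank E)) b0.
  have DH : is_diff (j b0) H ('d H (j b0)).
    exact: differentiableP (local_rep_diff hH).
  have D1 : is_diff b0 (H \o j) ('d H (j b0) \o (fun v => row_mx 0 v)).
    exact: is_diff_comp Dj DH.
  have D2 := row_affine_is_diff (cmap psi (f (tag e))) A' b0.
  (* Moving in the fibre over the base point, H is affine with linear part A. *)
  have near12 : \forall y \near b0, (H \o j) y = row_mx (cmap psi (f (tag e))) (A' y).
    have cj := differentiable_continuous (let: DiffDef dj _ := Dj in dj).
    have Wj : nbhs (j b0) W by exact: open_nbhs_nbhs (conj oW We).
    apply: (@filterS _ (nbhs b0) _ (fun y => W (j y)) _ _ (cj _ Wj)) => y /= Wy.
    have hy : cdom (total_chart phi s) (point_in (k y)) by split; [exact: hphi.2|].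
    have := WH _ hy; rewrite /= kK => /(_ Wy)[_ <-].
    by rewrite A'E.
  have D2' := is_diff_near (let: DiffDef d1 _ := D1 in d1) near12.
  have E1 := is_diffE D1 b; have E2 := is_diffE D2 b; have E3 := is_diffE D2' b.
  by rewrite -A'E -E2 E3 E1.
pose w1 := lsubmx (w (total_chart psi t)); pose w2 := rsubmx (w (total_chart psi t)).
have [a aE1] := submersion_coord w1 aX aY subf hphi hpsi hC.
have [b bE1] := surA (w2 - rsubmx ('d H (cmap (total_chart phi s) e) (row_mx a 0))).
have [v vE] := tangent_of_coord aE (row_mx a b) hchi.
exists v; apply: (tangent_ext aE' hchi').
rewrite (tmap_coord _ aE aE' hchi hchi' hH) vE.
have -> : row_mx a b = row_mx a 0 + row_mx 0 b.
  by rewrite add_row_mx addr0 add0r.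
rewrite linearD fibre bE1 -[w _]hsubmxK -/w1 -/w2.
rewrite -['d H _ _ in LHS]hsubmxK base row_mxKl aE1 add_row_mx addr0.
by congr row_mx; rewrite row_mxKr addrC subrK.
Qed.

(** Tangent vectors of the fibre product lie in the kernel of df - dg, which
    has dimension dim X + dim Y - dim Z as f is a submersion. That is the
    dimension of the fibre product, so the inclusion is an equality. *)
Lemma tangent_fibre_prod X Y Z (f : X -> Z) (g : Y -> Z) (p : fibre_prod f g)
    (v : tangent (fpr1 p)) (w : tangent (fpr2 p)) :
  has_atlas X -> has_atlas Y -> has_atlas Z -> submersion f -> smooth g ->
  (forall p : fibre_prod f g, exists chi, chart_at p chi) ->
  point_in (E := tangent_bundle Z) (tmap f v) =
    point_in (E := tangent_bundle Z) (tmap g w) ->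
  exists xi : tangent p, tmap (@fpr1 _ _ _ _ f g) xi = v /\
                         tmap (@fpr2 _ _ _ _ f g) xi = w.
Proof.
move=> aX aY aZ subf sg cov vw; have [sf _] := subf.
have aXY := mprod_atlas aX aY; have aP := submfd_atlas aXY cov.
have [phi hphi] := atlas_cover aX (fpr1 p).
have [psi hpsi] := atlas_cover aY (fpr2 p).
have [zeta hzeta] := atlas_cover aZ (f (fpr1 p)).
have hzeta' : chart_at (g (fpr2 p)) zeta by rewrite -(svalP p).
have [chi hchi] := cov p; have [[sl sc] _] := hchi.
have hpp : chart_at (sval p) (prod_chart phi psi : chart R (mprod X Y) _).
  split; first exact: atlas_prod hphi.1 hpsi.1.
  by split; [exact: hphi.2|exact: hpsi.2].
have [H hH] := smooth_at_local_rep aP aXY (smooth_sval aXY cov p) hchi hpp.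
have [C hC] := smooth_at_local_rep aX aZ (sf (fpr1 p)) hphi hzeta.
have [D hD] := smooth_at_local_rep aY aZ (sg (fpr2 p)) hpsi hzeta'.
have nphi := atlas_near aX hphi; have npsi := atlas_near aY hpsi.
have h1 : local_rep (@fpr1 _ _ _ _ f g) p chi phi (lsubmx \o H).
  exact: (local_rep_comp (g := fst) hchi.2 hH (local_rep_fst nphi npsi)).
have h2 : local_rep (@fpr2 _ _ _ _ f g) p chi psi (rsubmx \o H).
  exact: (local_rep_comp (g := snd) hchi.2 hH (local_rep_snd nphi npsi)).
have dl c : 'd (lsubmx \o H) (cmap chi p) c = lsubmx ('d H (cmap chi p) c).
  rewrite (local_rep_diff_comp (g := fst) hchi.2 hH (local_rep_fst nphi npsi) h1).
  exact: (congr1 (fun h => h _) (diff_linear (@lsubmx R 1 (mdim X) (mdim Y)) _)).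
have dr c : 'd (rsubmx \o H) (cmap chi p) c = rsubmx ('d H (cmap chi p) c).
  rewrite (local_rep_diff_comp (g := snd) hchi.2 hH (local_rep_snd nphi npsi) h2).
  exact: (congr1 (fun h => h _) (diff_linear (@rsubmx R 1 (mdim X) (mdim Y)) _)).
have fg : f \o @fpr1 _ _ _ _ f g = g \o @fpr2 _ _ _ _ f g.
  by apply/funext => q; exact: svalP q.
have ker c : 'd C (cmap phi (fpr1 p)) (lsubmx ('d H (cmap chi p) c)) =
    'd D (cmap psi (fpr2 p)) (rsubmx ('d H (cmap chi p) c)).
  have hfp := local_rep_comp hchi.2 h1 hC.
  have hgp := local_rep_comp hchi.2 h2 hD.
  have E1 := local_rep_diff_comp hchi.2 h1 hC hfp c.
  rewrite fg in hfp.
  have E2 := local_rep_diff_comp hchi.2 h2 hD hfp c.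
  by rewrite -dl -dr -E1 -E2.
pose k := (mdim X + mdim Y - mdim Z)%N.
pose M1 := lin1_mx ('d H (cmap chi p)).
pose M2 := col_mx (lin1_mx ('d C (cmap phi (fpr1 p))))
                  (- lin1_mx ('d D (cmap psi (fpr2 p)))).
have mulM2 u : u *m M2 = 'd C (cmap phi (fpr1 p)) (lsubmx u) -
    'd D (cmap psi (fpr2 p)) (rsubmx u).
  by rewrite -[u in LHS]hsubmxK mul_row_col mulmxN !mul_rV_lin1.
have M12 : M1 *m M2 = 0.
  apply/row_matrixP => i; rewrite row_mul row0 rowE mul_rV_lin1 mulM2.
  by rewrite ker subrr.
(* The transition back to the slice chart, followed by truncation, is a left
   inverse of the inclusion. *)
have freeM1 : row_free M1.
  have [m kn _ dom _] := sc.
  have [Q hQ] := maximal_trans aXY (atlas_maximal aXY hpp.1) m hpp.2 ((dom p).1 hchi.2).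
  have hpad := local_rep_sval aXY sc hchi.2.
  have dpad := local_rep_diff_comp (g := id) hchi.2 hH hQ hpad.
  apply/row_freeP; exists (lin1_mx ('d Q (cmap (prod_chart phi psi) (sval p))) *m
    pid_mx (mdim X + mdim Y - mdim Z)).
  apply/row_matrixP => i; rewrite !row_mul rowE mulmxA mul_rV_lin1 mul_rV_lin1.
  rewrite -dpad.
  rewrite (diff_linear_fun _ _ (mulmx_linear _)).
  rewrite -mulmxA mul_pid_mx minnn (minn_idPr kn) pid_mx_1 mulmx1.
  by rewrite rowE mulmx1.
have fullM2 : row_full M2.
  rewrite -sub1mx; apply/row_subP => i; apply/submxP.
  have [a aE] := submersion_coord (row i 1%:M) aX aZ subf hphi hzeta hC.
  by exists (row_mx a 0); rewrite mulM2 row_mxKl row_mxKr aE linear0 subr0.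
have kerM : (kermx M2 <= M1)%MS.
  have sub : (M1 <= kermx M2)%MS by apply/sub_kermxP.
  rewrite -(mxrank_leqif_sup sub).
  by rewrite mxrank_ker (eqP fullM2) (eqP freeM1).
have : (row_mx (v phi) (w psi) <= M1)%MS.
  apply: submx_trans kerM; apply/sub_kermxP; rewrite mulM2 row_mxKl row_mxKr.
  have Ev := tmap_coord v aX aZ hphi hzeta hC.
  have Ew := tmap_coord w aY aZ hpsi hzeta' hD.
  have := congr1 (fun z : total_space (tangent_bundle Z) =>
    fibre_coord (chart_triv zeta) z) vw.
  by rewrite /fibre_coord /= Ev Ew => ->; rewrite subrr.
move/submxP => [c cE]; rewrite mul_rV_lin1 in cE.
have [xi xiE] := tangent_of_coord aP c hchi.
exists xi; split.
  apply: (tangent_ext aX hphi).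
  by rewrite (tmap_coord _ aP aX hchi hphi h1) xiE dl -cE row_mxKl.
apply: (tangent_ext aY hpsi).
by rewrite (tmap_coord _ aP aY hchi hpsi h2) xiE dr -cE row_mxKr.
Qed.

End Submersions.

(** * Points of total spaces *)

Section Points.
Context {R : realType}.

Lemma point_in_inj (X : charted R) (E : vbundle X) x (e e' : E x) :
  point_in e = point_in e' -> e = e'.
Proof.
move=> H; have := projT2_eq H; rewrite (Prop_irrelevance (projT1_eq H) erefl).
by [].
Qed.

Lemma point_in_cast (X : charted R) (E : vbundle X) x y (e : E y) :
  x = y -> exists e' : E x, point_in e' = point_in e.
Proof. by move=> xy; subst y; exists e. Qed.

Lemma point_inD (X : charted R) (E : vbundle X) x y (a a' : E x) (b b' : E y) :
  point_in a = point_in b -> point_in a' = point_in b' ->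
  point_in (a + a') = point_in (b + b').
Proof.
move=> ab; have xy : x = y := congr1 (@tag _ _) ab; subst y.
by rewrite (point_in_inj ab) => /point_in_inj ->.
Qed.

Lemma point_in0 (X : charted R) (E : vbundle X) x y :
  x = y -> point_in (0 : E x) = point_in (0 : E y).
Proof. by move=> xy; subst y. Qed.

Lemma tmap_eq_fun (X Y : charted R) (f g : X -> Y) x (v : tangent x) :
  f =1 g -> point_in (E := tangent_bundle Y) (tmap f v) =
            point_in (E := tangent_bundle Y) (tmap g v).
Proof. by move=> /funext ->. Qed.

End Points.

(** * Bundles of equal rank and shears *)

Section BundleExtra.
Context {R : realType}.

Lemma same_rank_inj_surj (X Y : charted R) (E : vbundle X) (E' : vbundle Y)
    x y (F : E x -> E' y) : is_vbundle E -> is_vbundle E' ->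
  vrank E = vrank E' -> linear F ->
  injective F <-> (forall e', exists e, F e = e').
Proof.
move=> [tr cov _] [tr' cov' _] rk lF.
have [s hs Us] := cov x; have [t ht Ut] := cov' y.
have [ls [k sK kK]] := (tr _ hs).2 _ Us.
have [lt [k' tK kK']] := (tr' _ ht).2 _ Ut.
have lk : linear k.
  have [g gE] := linear_bundle ls.
  by move=> a u v; apply: (can_inj sK); rewrite kK -gE linearP /= gE !kK.
have lA : linear (fun c => t.2 _ (F (k c))) by move=> a u v; rewrite lk lF lt.
have [A AE] := linear_bundle lA.
have AP c : c *m lin1_mx A = t.2 _ (F (k c)) by rewrite mul_rV_lin1 AE.
have -> : injective F <-> row_free (lin1_mx A).
  split=> [injF|free e e' Fee'].
    rewrite -kermx_eq0; apply/eqP/row_matrixP => i.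
    have /sub_kermxP := row_sub i (kermx (lin1_mx A)).
    rewrite row0 AP => A0; apply: (can_inj kK); apply: injF; apply: (can_inj tK).
    by rewrite A0 -AP mul0mx.
  apply: (can_inj sK); apply: (row_free_inj free).
  by rewrite !AP !sK Fee'.
have -> : (forall e', exists e, F e = e') <-> row_full (lin1_mx A).
  split=> [surF|full e'].
    rewrite -sub1mx; apply/row_subP => i; apply/submxP.
    have [e eE] := surF (k' (row i 1%:M)).
    by exists (s.2 _ e); rewrite AP sK eE kK'.
  have /submxP[c cE] : (t.2 _ e' <= lin1_mx A)%MS by exact: submx_full.
  by exists (k c); apply: (can_inj tK); rewrite cE AP.
by split=> /eqP h; apply/eqP; rewrite h.
Qed.

Variables (X : charted R) (E1 E2 : vbundle X).
Hypotheses (aX : has_atlas X) (b1 : is_vbundle E1) (b2 : is_vbundle E2).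

(** Both components of the comparison map have this form. *)
Definition shear (beta : forall x, E1 x -> E2 x) :
    total_space (whitney_sum E1 E2) -> total_space (whitney_sum E1 E2) :=
  @total_map R X X (whitney_sum E1 E2) (whitney_sum E1 E2) id
    (fun x a => (a.1, a.2 + beta x a.1)).

Lemma smooth_shear (beta : forall x, E1 x -> E2 x) :
  smooth (@total_map R X X E1 E2 id beta) -> smooth (shear beta).
Proof.
move=> sbeta; have bw := whitney_vbundle aX b1 b2.
have s1 := smooth_whitney_fst aX b1 b2.
have s2 := smooth_whitney_snd aX b1 b2.
apply: (smooth_whitney_pair aX aX bw (smooth_id aX) b1 b2 s1).
apply: (smooth_bundleD aX aX bw (smooth_id aX) b2 s2).
exact: (smooth_comp (total_atlas aX b1) s1 sbeta).
Qed.

Lemma smooth_bundleN (beta : forall x, E1 x -> E2 x) :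
  smooth (@total_map R X X E1 E2 id beta) ->
  smooth (@total_map R X X E1 E2 id (fun x e => - beta x e)).
Proof.
move=> sb e; have [phi hphi] := atlas_cover aX (tag e).
have [_ cov1 _] := b1; have [s hs Us] := cov1 (tag e).
have [tr2 cov2 _] := b2; have [t ht Ut] := cov2 (tag e).
have hchi := total_chart_at hphi hs Us.
apply/(smooth_total_map_at _ aX aX b1 b2 (smooth_id aX) hphi hs Us ht Ut).
have sB := (smooth_total_map_at beta aX aX b1 b2 (smooth_id aX)
  hphi hs Us ht Ut).1 (sb e).
apply: (chart_smooth_eq _ (chart_smooth_linear (L := -%R) _ hchi.2 sB)).
  have htag := local_rep_tag aX b1 hphi hs Us.
  apply: chart_nearS (chart_near_comp hchi.2 htag (triv_near aX b2 hphi ht Ut)).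
  move=> z /= Uz; have [/linear_bundle[g gE] _] := (tr2 _ ht).2 _ Uz.
  by rewrite /fibre_coord /= -gE linearN.
by move=> a u v; rewrite opprD scalerN.
Qed.

Lemma shearK (beta : forall x, E1 x -> E2 x) :
  cancel (shear beta) (shear (fun x e => - beta x e)).
Proof. by move=> [x [v l]]; rewrite /shear /total_map /= addrK. Qed.

Lemma shearNK (beta : forall x, E1 x -> E2 x) :
  cancel (shear (fun x e => - beta x e)) (shear beta).
Proof. by move=> [x [v l]]; rewrite /shear /total_map /= subrK. Qed.

End BundleExtra.

(** * Submersions on graphs *)

Section GraphSubmersion.
Context {R : realType}.

(** The graph is diffeomorphic to its base X: a vector is lifted along t and
    pushed forward to the graph by the section. *)
Lemma graph_submersion (X Y Z T : charted R) (f : X -> Z) (g : Y -> Z)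
    (h : Z -> Y) (t : X -> T) :
  has_atlas X -> has_atlas Y -> has_atlas Z -> has_atlas T ->
  cancel g h -> cancel h g -> mdim Y = mdim Z -> smooth f -> smooth h ->
  submersion t ->
  submersion (fun p : fibre_prod f g => t (fpr1 p)).
Proof.
move=> aX aY aZ aT gK hK dimYZ sf sh [st subt].
have cov := graph_fibre_prod_cover aX aY aZ gK hK dimYZ sf sh.
have aP := submfd_atlas (mprod_atlas aX aY) cov.
have s1 := (smooth_fpr aX aY cov).1.
have ss := smooth_graph_section aX aY aZ gK hK dimYZ sf sh.
have stf : smooth (t \o @fpr1 _ _ _ _ f g) by exact: smooth_comp aX s1 st.
split=> // p; rewrite -(graph_sectionK gK hK p).
move: (fpr1 p) => x w; have [u uw] := subt x w.
exists (tmap (graph_section f hK) u).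
by rewrite -uw -(tmap_comp u aX aP aT (ss x) (stf _)).
Qed.

End GraphSubmersion.

(** * Cancellation in groupoids *)

Section GroupoidAlgebra.
Context {R : realType} (G : gpd R).
Hypothesis gG : is_groupoid G.

Lemma gmul_congr (m m' k k' : arrows G) (e : gsrc m = gtgt k)
    (e' : gsrc m' = gtgt k') : m = m' -> k = k' ->
  gmul (comp_pair e) = gmul (comp_pair e').
Proof.
move=> mm kk; subst m' k'; congr gmul; congr comp_pair.
exact: Prop_irrelevance.
Qed.

(** a = (a z) z^-1, where the two composability proofs of each step have to
    be matched. *)
Lemma gmul_cancelr (a b z : arrows G) (ea : gsrc a = gtgt z)
    (eb : gsrc b = gtgt z) :
  gmul (comp_pair ea) = gmul (comp_pair eb) -> a = b.
Proof.
have [_ inv_st mul_st assoc unit_inv] := gG.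
(* (c z) z^-1 = c *)
suff mulK c (ec : gsrc c = gtgt z) :
    exists e : gsrc (gmul (comp_pair ec)) = gtgt (ginv z), gmul (comp_pair e) = c.
  move=> E; have [e1 <-] := mulK a ea; have [e2 <-] := mulK b eb.
  exact: gmul_congr.
have ez : gsrc z = gtgt (ginv z) by rewrite (inv_st z).2.
have e : gsrc (gmul (comp_pair ec)) = gtgt (ginv z).
  by rewrite (mul_st _).1 (inv_st z).2.
have e' : gsrc c = gtgt (gmul (comp_pair ez)).
  by rewrite (mul_st _).2 ec.
exists e; rewrite (assoc _ _ _ ec ez e e').
have [unitr _ _ _] := unit_inv c; have [_ _ mulV _] := unit_inv z.
have ec1 : gsrc c = gtgt (gunit (gsrc c)).
  by have [u_st _ _ _ _] := gG; rewrite (u_st _).2.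
rewrite -[RHS](unitr ec1); apply: gmul_congr => //.
by rewrite mulV ec.
Qed.

End GroupoidAlgebra.

(** * Line bundle-groupoids *)

Section LBG.
Context {R : realType} (L : vbg R).
Hypothesis lbgL : is_lbg L.
Let G := base L.
Let T := vtotal L.

Lemma lbg_facts :
  [/\ is_lie_groupoid G, is_lie_groupoid T, is_vbundle (varr L),
      is_vbundle (vobj L) & vrank (varr L) = vrank (vobj L)].
Proof. by case: lbgL => -[[? ?] [? ?] _ _ _] -> ->. Qed.

Lemma vsrc_linear g : linear (@vsrc R L g).
Proof. by case: lbgL => -[_ _ /(_ g)[]]. Qed.

Lemma vtgt_linear g : linear (@vtgt R L g).
Proof. by case: lbgL => -[_ _ /(_ g)[]]. Qed.

Lemma linear_map0 (U V : lmodType R) (F : U -> V) : linear F -> F 0 = 0.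
Proof. by move=> /linear_bundle[g <-]; rewrite linear0. Qed.

Lemma linear_inj0 (U V : lmodType R) (F : U -> V) : linear F ->
  (forall u, F u = 0 -> u = 0) -> injective F.
Proof.
move=> /linear_bundle[g <-] H u v /eqP; rewrite -subr_eq0 -linearB => /eqP /H.
by move/eqP; rewrite subr_eq0 => /eqP.
Qed.

(** The unit map gives a section of s over the units, so s is onto there, and
    the ranks agree. *)
Lemma vsrc_inj_unit g x : g = gunit x -> injective (@vsrc R L g).
Proof.
move=> ->; have [lG lT bA bO rk] := lbg_facts.
apply/(same_rank_inj_surj bA bO rk (@vsrc_linear _)) => l.
have [_ [/(_ x)[ux _] _ _ _ _] _ _ _] := lG.
have [y yl] := point_in_cast l (esym ux).
exists (vunt y); apply: point_in_inj; rewrite -yl.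
have [_ [/(_ (point_in y))[uy _] _ _ _ _] _ _ _] := lT.
exact: uy.
Qed.

(** If l lies over g and s(l) = 0, then l and 0_g are both composable with
    the zero of the fibre over g^-1. Both products lie over a unit and have source
    0, hence vanish, and cancellation gives l = 0_g. *)
Lemma vsrc_inj g : injective (@vsrc R L g).
Proof.
have [lG lT bA bO rk] := lbg_facts.
have [_ gG _ _ _] := lG; have [_ gT _ _ _] := lT.
have [_ inv_st mul_st _ _] := gG; have [_ _ mul_stT _ _] := gT.
apply: (linear_inj0 (@vsrc_linear g)) => l l0.
pose z : arrows T := point_in (0 : varr L (ginv g)).
have zt : gtgt z = point_in (0 : vobj L (gsrc g)).
  rewrite /z /= /total_map /= (linear_map0 (@vtgt_linear _)).
  exact/point_in0/(inv_st g).2.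
have El : gsrc (point_in l : arrows T) = gtgt z.
  by rewrite zt /= /total_map /= l0.
have E0 : gsrc (point_in (0 : varr L g) : arrows T) = gtgt z.
  by rewrite zt /= /total_map /= (linear_map0 (@vsrc_linear _)).
have eg : gsrc g = gtgt (ginv g) by rewrite (inv_st g).2.
have [_ _ _ _ ui] := gG; have [_ _ /(_ eg) unit_gg _] := ui g.
have prod0 (a : varr L g) (E : gsrc (point_in a : arrows T) = gtgt z) :
    gmul (comp_pair E) = point_in (0 : varr L (gunit (gtgt g))) :> arrows T.
  have st := (mul_stT (comp_pair E)).1.
  have tagE : tag (gmul (comp_pair E)) = gunit (gtgt g).
    rewrite -unit_gg /=; exact: gmul_congr.
  move: (gmul (comp_pair E)) st tagE => m st tagE.
  case: m st tagE => k mu /= st kE; subst k.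
  have : point_in (vsrc mu) = point_in (0 : vobj L (gsrc (gunit (gtgt g)))).
    apply: etrans st _.
    rewrite /z /fpr2 /= /total_map /= (linear_map0 (@vsrc_linear _)).
    apply: point_in0; rewrite (inv_st g).1.
    by have [u_st _ _ _ _] := gG; rewrite (u_st _).1.
  move=> /point_in_inj mu0; congr point_in.
  by apply: (vsrc_inj_unit erefl); rewrite mu0 (linear_map0 (@vsrc_linear _)).
apply: point_in_inj; apply: (gmul_cancelr gT (ea := El) (eb := E0)).
by rewrite !prod0.
Qed.

Lemma vsrc_surj g l : exists e, @vsrc R L g e = l.
Proof.
have [_ _ bA bO rk] := lbg_facts.
have /(same_rank_inj_surj bA bO rk (@vsrc_linear g)) := @vsrc_inj g.
exact.
Qed.

(** As t is s composed with the inversion, an l in the kernel of t_g has the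
    same inverse as 0_g, and is recovered from it by cancellation. *)
Lemma vtgt_inj g : injective (@vtgt R L g).
Proof.
have [lG lT bA bO rk] := lbg_facts.
have [_ gG _ _ _] := lG; have [_ inv_st _ _ _] := gG.
have [_ gT _ _ _] := lT; have [_ inv_stT _ _ uiT] := gT.
have linvL : linear (@vinv R L g) by case: lbgL => -[_ _ _ [_ /(_ g)]].
apply: (linear_inj0 (@vtgt_linear g)) => l l0.
pose e : arrows T := point_in l; pose e0 : arrows T := point_in (0 : varr L g).
have tE : gtgt e = gtgt e0.
  by rewrite /= /total_map /= l0 (linear_map0 (@vtgt_linear _)).
have iE : ginv e = ginv e0.
  rewrite /= /total_map /= (linear_map0 linvL); congr point_in.
  apply: vsrc_inj; rewrite (linear_map0 (@vsrc_linear _)).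
  have := (inv_stT e).1; rewrite /= /total_map /= l0 => vE.
  apply: point_in_inj; apply: etrans vE _.
  exact/point_in0/esym/(inv_st g).1.
have ea : gsrc e = gtgt (ginv e) by rewrite (inv_stT e).2.
have eb : gsrc e0 = gtgt (ginv e) by rewrite iE (inv_stT e0).2.
have eb' : gsrc e0 = gtgt (ginv e0) by rewrite (inv_stT e0).2.
apply: point_in_inj; apply: (gmul_cancelr gT (ea := ea) (eb := eb)).
have [_ _ -> _] := uiT e; rewrite tE.
have [_ _ /(_ eb') <- _] := uiT e0.
exact: gmul_congr.
Qed.

Lemma vtgt_surj g l : exists e, @vtgt R L g e = l.
Proof.
have [_ _ bA bO rk] := lbg_facts.
have /(same_rank_inj_surj bA bO rk (@vtgt_linear g)) := @vtgt_inj g.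
exact.
Qed.

Lemma src_invE g (l : varr L g) y : point_in (vsrc l) = y -> src_inv g y = l.
Proof.
move=> E; rewrite /src_inv /fibre_inv; case: xgetP => [e _ Ee|/(_ l)//].
by apply: vsrc_inj; apply: point_in_inj; rewrite E.
Qed.

Lemma src_invK g y : gsrc g = tag y ->
  point_in (vsrc (src_inv (L := L) g y)) = y.
Proof.
case: y => x l /= gx; have [l' l'E] := point_in_cast l gx.
have [e eE] := vsrc_surj l'.
have E : point_in (vsrc e) = point_in l by rewrite eE.
by rewrite (src_invE E).
Qed.

Variable alpha : forall x : objects G, tangent x -> vobj L x.

Lemma vsrc_pullback g (v : tangent g) :
  vsrc (pullback1 (@vsrc R L) alpha v) = alpha (tmap (@gsrc R G) v).
Proof.
rewrite /pullback1 /fibre_inv; case: xgetP => [e _ //|].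
by have [e eE] := vsrc_surj (alpha (tmap (@gsrc R G) v)) => /(_ e).
Qed.

Lemma vtgt_pullback g (v : tangent g) :
  vtgt (pullback1 (@vtgt R L) alpha v) = alpha (tmap (@gtgt R G) v).
Proof.
rewrite /pullback1 /fibre_inv; case: xgetP => [e _ //|].
by have [e eE] := vtgt_surj (alpha (tmap (@gtgt R G) v)) => /(_ e).
Qed.

Lemma groupoid_atlas : has_atlas (arrows G) /\ has_atlas (objects G).
Proof.
have [[[mA mO] _ _ _ _] _ _ _ _] := lbg_facts.
by split; exact: manifold_atlas.
Qed.

Lemma comp_pairs_cover (p : comp_pairs G) : exists chi, chart_at p chi.
Proof.
have [[_ _ _ _ sm] _ _ _ _] := lbg_facts.
by have [phi [psi [F [h _ _]]]] := sm p; exists phi.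
Qed.

(** The identity s(gh) = s(h) differentiates to ds(vv') = ds(v'). For this
    (v, v') must come from a vector tangent to the manifold of composable pairs,
    as otherwise vv' would be the differential of m at the default vector 0. *)
Lemma tmap_src_mul (p : comp_pairs G) (v : tangent (fpr1 p))
    (w : tangent (fpr2 p)) :
  point_in (E := tangent_bundle _) (tmap (@gsrc R G) v) =
    point_in (E := tangent_bundle _) (tmap (@gtgt R G) w) ->
  point_in (E := tangent_bundle _) (tmap (@gsrc R G) (tangent_mul v w)) =
    point_in (E := tangent_bundle _) (tmap (@gsrc R G) w).
Proof.
move=> vw; have [[_ gG [ss st] _ sm] _ _ _ _] := lbg_facts.
have [aA aO] := groupoid_atlas.
have aP := submfd_atlas (mprod_atlas aA aA) comp_pairs_cover.
have [s1 s2] := smooth_fpr aA aA comp_pairs_cover.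
have [_ _ mul_st _ _] := gG.
rewrite /tangent_mul; case: xgetP => [xi _ [_ xi2]|].
  have E1 := tmap_comp xi aP aA aO (sm p) (ss.1 _).
  have E2 := tmap_comp xi aP aA aO (s2 p) (ss.1 _).
  rewrite xi2 in E2.
  have E : @gsrc R G \o @gmul R G =1 @gsrc R G \o @fpr2 _ _ _ _ _ _.
    by move=> q; exact: (mul_st q).1.
  exact: etrans (congr1 (@point_in _ _ (tangent_bundle _) _) (esym E1))
    (etrans (tmap_eq_fun xi E) (congr1 (@point_in _ _ (tangent_bundle _) _) E2)).
have [xi xiE] := tangent_fibre_prod aA aA aO ss st.1 comp_pairs_cover vw.
by move=> /(_ xi).
Qed.

Section Form.
Hypothesis fa : is_form1 alpha.

Lemma pullback_linear g : linear (@pullback1 R _ _ _ _ _ (@vsrc R L) alpha g).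
Proof.
have [[_ _ [[ss _] _] _ _] _ _ _ _] := lbg_facts; have [aA aO] := groupoid_atlas.
move=> a v w; apply: vsrc_inj; rewrite vsrc_linear !vsrc_pullback.
by rewrite (tmap_linear aA aO (ss g)) fa.1.
Qed.

(** s^*alpha is the quotient of alpha o ds by s, on the line bundle L. *)
Lemma smooth_pullback :
  smooth (@total_map R _ _ (tangent_bundle (arrows G)) (varr L) id
            (pullback1 (@vsrc R L) alpha)).
Proof.
have [[_ _ [[ss _] _] _ _] lT bA bO rk] := lbg_facts.
have [aA aO] := groupoid_atlas.
have [_ r1 r0] := lbgL.
have [_ _ [[sS _] _] _ _] := lT.
apply: (smooth_bundle_div aA aO (tangent_vbundle aA) ss
  (A := fun g (v : tangent g) => alpha (tmap (@gsrc R G) v)) bA bO r1 r0 _ sS).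
- exact: (smooth_comp (total_atlas aO (tangent_vbundle aO))
    (smooth_total_tmap aA aO ss) fa.2).
- by move=> g; split; [exact: vsrc_linear|exact: vsrc_inj].
- by move=> g v; exact: vsrc_pullback.
Qed.

End Form.
End LBG.

(** * Source and target of the Morita kernel *)

Section MoritaKernelMaps.
Context {R : realType} (L : vbg R).
Hypothesis lbgL : is_lbg L.
Let G := base L.
Variable theta : forall g : arrows G, tangent g -> varr L g.
Hypothesis ft : is_form1 theta.
Let V := whitney_sum (tangent_bundle (arrows G)) (varr L).
Let VM := whitney_sum (tangent_bundle (objects G)) (vobj L).

Lemma kernel_bundles : is_vbundle V /\ is_vbundle VM.
Proof.
have [_ _ bA bO _] := lbg_facts lbgL; have [aA aO] := groupoid_atlas lbgL.
by split; apply: whitney_vbundle => //; exact: tangent_vbundle.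
Qed.

Lemma kernel_atlases : has_atlas (total_space V) /\ has_atlas (total_space VM).
Proof.
have [bV bVM] := kernel_bundles; have [aA aO] := groupoid_atlas lbgL.
by split; exact: total_atlas.
Qed.

Lemma smooth_mk_src : smooth (@total_map R _ _ V VM _ (@mk_src R L)).
Proof.
have [[_ _ [[ss _] _] _ _] [_ _ [[sS _] _] _ _] bA bO _] := lbg_facts lbgL.
have [aA aO] := groupoid_atlas lbgL; have [bV bVM] := kernel_bundles.
have bTA := tangent_vbundle aA; have bTO := tangent_vbundle aO.
have s1 : smooth (@total_map R _ _ V (tangent_bundle (objects G)) _
    (fun g (a : V g) => tmap (@gsrc R G) a.1)).
  exact: (smooth_comp (total_atlas aA bTA) (smooth_whitney_fst aA bTA bA)
    (smooth_total_tmap aA aO ss)).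
have s2 : smooth (@total_map R _ _ V (vobj L) _ (fun g (a : V g) => vsrc a.2)).
  exact: (smooth_comp (total_atlas aA bA) (smooth_whitney_snd aA bTA bA) sS).
exact: (smooth_whitney_pair aA aO bV ss bTO bO s1 s2).
Qed.

Lemma smooth_mk_tgt : smooth (@total_map R _ _ V VM _ (@mk_tgt R L theta)).
Proof.
have [[_ _ [_ [st _]] _ _] [_ _ [_ [sT _]] _ _] bA bO _] := lbg_facts lbgL.
have [aA aO] := groupoid_atlas lbgL; have [bV bVM] := kernel_bundles.
have bTA := tangent_vbundle aA; have bTO := tangent_vbundle aO.
have s1 : smooth (@total_map R _ _ V (tangent_bundle (objects G)) _
    (fun g (a : V g) => tmap (@gtgt R G) a.1)).
  exact: (smooth_comp (total_atlas aA bTA) (smooth_whitney_fst aA bTA bA)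
    (smooth_total_tmap aA aO st)).
have s2 : smooth (@total_map R _ _ V (varr L) id (fun g a => a.2 + theta a.1)).
  apply: (smooth_bundleD aA aA bV (smooth_id aA) bA
    (smooth_whitney_snd aA bTA bA)).
  exact: (smooth_comp (total_atlas aA bTA) (smooth_whitney_fst aA bTA bA) ft.2).
exact: (smooth_whitney_pair aA aO bV st bTO bO s1
  (smooth_comp (total_atlas aA bA) s2 sT)).
Qed.

Lemma mk_tgt_surj g (b : VM (gtgt g)) : exists a : V g, mk_tgt theta a = b.
Proof.
have [[_ _ [_ [_ st]] _ _] _ _ _ _] := lbg_facts lbgL.
case: b => v l; have [v' v'E] := st g v; have [l' l'E] := vtgt_surj lbgL l.
exists (v', l' - theta v'); rewrite /mk_tgt /= subrK.
by congr pair.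
Qed.

(** On the fibre over g the target is (v, l) |-> (dt v, t(l + theta v)), which
    is onto because dt and t_g are. *)
Lemma mk_tgt_submersion : submersion (@total_map R _ _ V VM _ (@mk_tgt R L theta)).
Proof.
have [[_ _ [_ st] _ _] _ bA bO _] := lbg_facts lbgL.
have [aA aO] := groupoid_atlas lbgL; have [bV bVM] := kernel_bundles.
apply: (total_map_submersion aA aO bV bVM st smooth_mk_tgt) => g; split.
  move=> a [v l] [v' l']; rewrite /mk_tgt /=; congr pair.
    exact: (tmap_linear aA aO (st.1 g)).
  by rewrite -(vtgt_linear lbgL) ft.1 scalerDr addrACA.
exact: mk_tgt_surj.
Qed.

End MoritaKernelMaps.

(** * The comparison map *)

Section Comparison.
Context {R : realType} (L : vbg R).
Let G := base L.
Variables (theta theta' : forall g : arrows G, tangent g -> varr L g)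
  (alpha : forall x : objects G, tangent x -> vobj L x).
Hypotheses (lbgL : is_lbg L) (ft : is_form1 theta) (ft' : is_form1 theta')
  (fa : is_form1 alpha).
Hypothesis cohom : forall (g : arrows G) (v : tangent g),
  theta v - theta' v = coboundary0 alpha v.

Let W := morita_kernel theta.
Let V := morita_kernel theta'.
Let A1 := @comparison_arr R L theta theta' alpha.
Let A0 := @comparison_obj R L theta theta' alpha.
Let F1 : arrows (vtotal W) -> arrows (vtotal V) :=
  @total_map R _ _ (varr W) (varr V) id A1.
Let F0 : objects (vtotal W) -> objects (vtotal V) :=
  @total_map R _ _ (vobj W) (vobj V) id A0.

Lemma comparison_id_morphism : @is_lie_groupoid_morphism R G G id id.
Proof.
have [aA aO] := groupoid_atlas lbgL.
split=> //; first by split; exact: smooth_id.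
move=> [[a b] e] [[a' b'] e'] /= h1 h2; rewrite /fpr1 /fpr2 /= in h1 h2.
by subst a' b'; congr gmul; congr exist; exact: Prop_irrelevance.
Qed.

Lemma comparison_src (h : arrows (vtotal W)) : gsrc (F1 h) = F0 (gsrc h).
Proof.
case: h => g [v l]; congr point_in; congr pair => /=.
have [f fE] := linear_bundle (@vsrc_linear R L lbgL g).
by rewrite -fE linearD /= fE (vsrc_pullback lbgL).
Qed.

(** The cohomology relation says that l + s^*alpha(v) + theta'(v) and
    l + theta(v) differ by t^*alpha(v), whose image under t is alpha(dt v). *)
Lemma cohom_tgt g (v : tangent g) (l : varr L g) :
  vtgt (l + pullback1 (@vsrc R L) alpha v + theta' v) =
  vtgt (l + theta v) + alpha (tmap (@gtgt R G) v).
Proof.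
have -> : theta v = pullback1 (@vsrc R L) alpha v -
    pullback1 (@vtgt R L) alpha v + theta' v.
  by apply/eqP; rewrite -subr_eq; apply/eqP/cohom.
rewrite -(vtgt_pullback lbgL).
have [f fE] := linear_bundle (@vtgt_linear R L lbgL g).
by rewrite -fE -linearD; congr (f _); rewrite [X in _ = _ + X + _]addrAC !addrA subrK.
Qed.

Lemma comparison_tgt (h : arrows (vtotal W)) : gtgt (F1 h) = F0 (gtgt h).
Proof.
case: h => g [v l]; congr point_in; congr pair => /=.
exact: cohom_tgt.
Qed.

Lemma alpha_point x y (v : tangent (x : objects G)) (w : tangent (y : objects G)) :
  point_in (E := tangent_bundle _) v = point_in (E := tangent_bundle _) w ->
  point_in (alpha v) = point_in (alpha w).
Proof.
move=> vw; have xy : x = y := congr1 (@tag _ _) vw; subst y.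
by rewrite (point_in_inj vw).
Qed.

(** After applying the injective map s_g, the claim becomes ds(du v) = v. *)
Lemma comparison_unit (y : objects (vtotal W)) : F1 (gunit y) = gunit (F0 y).
Proof.
case: y => x [v l]; congr point_in; congr pair => /=.
have [[_ gG [[ss _] _] [su _] _] [_ gT _ _ _] _ _ _] := lbg_facts lbgL.
have [aA aO] := groupoid_atlas lbgL.
have lu : linear (@vunt R L x) by case: lbgL => -[_ _ _ [/(_ x)]].
have [f fE] := linear_bundle lu.
rewrite -fE linearD /= fE; congr (_ + _).
apply: (vsrc_inj lbgL); rewrite (vsrc_pullback lbgL); apply: point_in_inj.
have [u_stT _ _ _ _] := gT; have [u_st _ _ _ _] := gG.
apply: etrans (esym (u_stT (point_in (alpha v))).1).
apply: alpha_point.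
have E1 := tmap_comp v aO aA aO (su x) (ss _).
have E : @gsrc R G \o @gunit R G =1 id by move=> z; exact: (u_st z).1.
have := tmap_eq_fun v E; rewrite (tmap_id _ aO) => <-.
exact: (congr1 (@point_in _ _ (tangent_bundle _) _) (esym E1)).
Qed.

(** After applying the injective map s_g, the claim becomes ds(v^-1) = dt v. *)
Lemma comparison_inv (h : arrows (vtotal W)) : F1 (ginv h) = ginv (F1 h).
Proof.
case: h => g [v l]; congr point_in; congr pair => /=.
have [[_ gG [[ss _] [st _]] [_ si] _] [_ gT _ _ _] _ _ _] := lbg_facts lbgL.
have [aA aO] := groupoid_atlas lbgL.
have [_ inv_st _ _ _] := gG.
apply/esym; apply: (src_invE lbgL).
have [f fE] := linear_bundle (@vsrc_linear R L lbgL (ginv g)).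
rewrite -fE linearD /= fE cohom_tgt (vsrc_pullback lbgL).
apply: point_inD; first by apply: (src_invK lbgL) => /=; exact: (inv_st g).1.
apply: alpha_point.
have E1 := tmap_comp v aA aA aO (si g) (ss _).
have E : @gsrc R G \o @ginv R G =1 @gtgt R G by move=> z; exact: (inv_st z).1.
rewrite -(tmap_eq_fun v E).
exact: (congr1 (@point_in _ _ (tangent_bundle _) _) (esym E1)).
Qed.

(** The composability of the base arrows is a parameter here, in order that
    products in two Morita kernels can be compared over the same arrow. *)
Lemma kernel_mulE (th : forall g : arrows G, tangent g -> varr L g)
    (a b : arrows (vtotal (morita_kernel th))) (e : gsrc a = gtgt b)
    (e0 : gsrc (tag a) = gtgt (tag b)) :
  gmul (comp_pair e) = point_in (E := varr (morita_kernel th))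
    (tangent_mul (p := comp_pair e0) (tagged a).1 (tagged b).1,
     src_inv (L := L) (gmul (comp_pair e0))
       (point_in (E := vobj L) (@vsrc R L _ (tagged b).2))).
Proof.
have -> : e0 = congr1 (@tag _ _) (svalP (comp_pair e)) by exact: Prop_irrelevance.
transitivity (point_in (E := varr (morita_kernel th)) (@vmul R (morita_kernel th)
  (comp_pair (congr1 (@tag _ _) (svalP (comp_pair e))))
  (exist _ (tagged a, tagged b) (svalP (comp_pair e))))).
  reflexivity.
reflexivity.
Qed.

(** After applying the injective map s_g, the claim becomes ds(vv') = ds(v'). *)
Lemma comparison_mul_pair (a b : arrows (vtotal W)) (e : gsrc a = gtgt b)
    (e' : gsrc (F1 a) = gtgt (F1 b)) :
  F1 (gmul (comp_pair e)) = gmul (comp_pair e').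
Proof.
case: a b e e' => [g [v l]] [h [v' l']] e e'.
have e0 : @gsrc R G g = @gtgt R G h.
  exact: (congr1 (fun z : total_space (vobj W) => tag z) e).
apply: (etrans (congr1 F1 (kernel_mulE e e0))).
apply: (etrans _ (esym (kernel_mulE e' e0))).
congr point_in; congr pair => /=.
have [[_ gG _ _ _] _ _ _ _] := lbg_facts lbgL.
have [_ _ mul_st _ _] := gG.
apply/esym; apply: (src_invE lbgL).
have [f fE] := linear_bundle (@vsrc_linear R L lbgL (gmul (comp_pair e0))).
have [f' f'E] := linear_bundle (@vsrc_linear R L lbgL h).
rewrite -fE linearD /= fE -f'E linearD /= f'E !(vsrc_pullback lbgL).
apply: point_inD.
  by apply: (src_invK lbgL) => /=; exact: (mul_st (comp_pair e0)).1.
apply: alpha_point; apply: (tmap_src_mul lbgL).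
exact: (congr1 (@total_map R _ _ (whitney_sum (tangent_bundle (objects G)) (vobj L))
  (tangent_bundle (objects G)) id (fun x a => a.1)) e).
Qed.

Lemma comparison_mul (p : comp_pairs (vtotal W)) (q : comp_pairs (vtotal V)) :
  fpr1 q = F1 (fpr1 p) -> fpr2 q = F1 (fpr2 p) -> F1 (gmul p) = gmul q.
Proof.
case: p q => [[a b] e] [[a' b'] e'] h1 h2.
have {}h1 : a' = F1 a := h1; have {}h2 : b' = F1 b := h2.
by subst a' b'; exact: comparison_mul_pair.
Qed.

Let B1 : arrows (vtotal V) -> arrows (vtotal W) :=
  shear (fun g (v : tangent_bundle (arrows G) g) =>
    - pullback1 (@vsrc R L) alpha v).
Let B0 : objects (vtotal V) -> objects (vtotal W) :=
  shear (fun x (v : tangent_bundle (objects G) x) => - alpha v).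

Lemma comparison_cancel :
  [/\ cancel F1 B1, cancel B1 F1, cancel F0 B0 & cancel B0 F0].
Proof.
split.
- exact: (@shearK R _ (tangent_bundle (arrows G)) (varr L)
    (fun g v => pullback1 (@vsrc R L) alpha v)).
- exact: (@shearNK R _ (tangent_bundle (arrows G)) (varr L)
    (fun g v => pullback1 (@vsrc R L) alpha v)).
- exact: (@shearK R _ (tangent_bundle (objects G)) (vobj L) alpha).
- exact: (@shearNK R _ (tangent_bundle (objects G)) (vobj L) alpha).
Qed.

Lemma comparison_smooth : [/\ smooth F1, smooth F0, smooth B1 & smooth B0].
Proof.
have [_ _ bA bO _] := lbg_facts lbgL; have [aA aO] := groupoid_atlas lbgL.
have bTA := tangent_vbundle aA; have bTO := tangent_vbundle aO.
have sp := smooth_pullback lbgL fa.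
split.
- exact: (smooth_shear aA bTA bA sp).
- exact: (smooth_shear aO bTO bO fa.2).
- exact: (smooth_shear aA bTA bA (smooth_bundleN aA bTA bA sp)).
- exact: (smooth_shear aO bTO bO (smooth_bundleN aO bTO bO fa.2)).
Qed.

Lemma comparison_morphism :
  @is_lie_groupoid_morphism R (vtotal W) (vtotal V) F1 F0.
Proof.
have [sF1 sF0 _ _] := comparison_smooth; split=> //.
- by move=> h; split; [exact: comparison_src|exact: comparison_tgt].
- exact: comparison_unit.
- exact: comparison_inv.
- exact: comparison_mul.
Qed.

(** A map a into the codomain factors uniquely through F1, as B1 o a; since F0
    is injective, the sources and targets then match as well. *)
Lemma comparison_fibre_product :
  @is_fibre_product R (arrows (vtotal W)) (arrows (vtotal V))
    (mprod (objects (vtotal W)) (objects (vtotal W)))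
    (mprod (objects (vtotal V)) (objects (vtotal V)))
    F1 (@src_tgt R (vtotal W)) (@src_tgt R (vtotal V))
    (fun y => (F0 y.1, F0 y.2)).
Proof.
have [sF1 sF0 sB1 sB0] := comparison_smooth.
have [FK1 BK1 FK0 BK0] := comparison_cancel.
have [aV aVM] := kernel_atlases lbgL.
split=> //.
- exact: (smooth_pair aVM aVM aV (smooth_mk_src lbgL) (smooth_mk_tgt lbgL ft)).
- by move=> h; rewrite /src_tgt comparison_src comparison_tgt.
- move=> T a b mT sa sb E; exists (B1 \o a); split; first split.
  + exact: (smooth_comp aV sa sB1).
  + by move=> z; exact: BK1.
  + move=> z; have := E z; rewrite /src_tgt -[in LHS](BK1 (a z)).
    rewrite comparison_src comparison_tgt => Ez.
    have Es := can_inj FK0 (congr1 fst Ez); have Et := can_inj FK0 (congr1 snd Ez).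
    by rewrite /src_tgt /comp Es Et; case: (b z).
  + move=> c [_ ca _]; apply/funext => z.
    by rewrite /= -(ca z) FK1.
Qed.

(** As F0 is invertible, the fibre product is a graph over the arrows of the
    codomain, where the map in question is the target map. *)
Lemma comparison_essentially_surjective :
  surjective_submersion
    (fun p : fibre_prod (@gsrc R (vtotal V)) F0 => gtgt (fpr1 p)).
Proof.
have [sF1 sF0 sB1 sB0] := comparison_smooth.
have [FK1 BK1 FK0 BK0] := comparison_cancel.
have [aV aVM] := kernel_atlases lbgL.
split.
  exact: (graph_submersion aV aVM aVM aVM FK0 BK0 erefl (smooth_mk_src lbgL) sB0
    (mk_tgt_submersion lbgL ft')).
case=> x b; have [[_ gG _ _ _] _ _ _ _] := lbg_facts lbgL.
have [u_st _ _ _ _] := gG.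
have [b' b'E] := point_in_cast (E := vobj V) b (u_st x).2.
have [a aE] := mk_tgt_surj lbgL theta' b'.
exists (graph_section (@gsrc R (vtotal V)) BK0 (point_in a)).
by rewrite /= /total_map /= aE; exact: b'E.
Qed.

End Comparison.
Theorem proposition5p3p12 (R : realType) (L : vbg R)
    (theta theta' : forall g : arrows (base L), tangent g -> varr L g)
    (alpha : forall x : objects (base L), tangent x -> vobj L x) :
  is_lbg L ->
  is_form1 theta -> multiplicative_form theta ->
  is_form1 theta' -> multiplicative_form theta' ->
  is_form1 alpha ->
  (forall (g : arrows (base L)) (v : tangent g),
     theta g v - theta' g v = coboundary0 alpha v) ->
  @is_vb_morita_map R (morita_kernel theta) (morita_kernel theta') id id
    (comparison_arr theta' alpha) (comparison_obj theta' alpha).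
Proof.
move=> lbgL ft mt ft' mt' fa cohom; split.
  split.
  - exact: (comparison_id_morphism lbgL).
  - exact: (comparison_morphism lbgL fa cohom).
  - move=> g a [v l] [v' l']; congr pair => /=.
    by rewrite [pullback1 _ _ _](pullback_linear lbgL fa) addrACA -scalerDr.
  - move=> x a [v l] [v' l']; congr pair => /=.
    by rewrite [alpha _ _](fa.1 x) addrACA -scalerDr.
split.
- exact: (comparison_morphism lbgL fa cohom).
- exact: (comparison_fibre_product lbgL ft fa cohom).
- exact: (comparison_essentially_surjective theta lbgL ft' fa).
Qed.
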